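(* Let $\mu$ be an $S$-stable profile (viewed as a stationary solution of the quasineutral Vlasov equation $\partial_t f+v\partial_xf-\partial_xV\partial_vf=0$, $\int f\,dv=1$), written $\mu(v)=\varphi\bigl(-\frac{|v-\bar v|^2}{2}\bigr)$, and let $Q$ be an associated admissible function with Casimir functional $H_Q$. Assume that there exists $\eta>0$ such that $$\int_{\mathbb R} \mu(v)(1+|v|^{2+\eta})\,dv<+\infty.$$ For all $\varepsilon>0$, let $(f_\varepsilon,V_\varepsilon)$ be a strong solution to $$\partial_t f_\varepsilon + v\,\partial_x f_\varepsilon - \partial_x V_\varepsilon\,\partial_v f_\varepsilon=0,\qquad -\varepsilon^2\partial_x^2 V_\varepsilon=\int_{\mathbb R} f_\varepsilon\,dv-1 \qquad (x\in\mathbb T,\ v\in\mathbb R),$$ with initial datum $f_{0,\varepsilon}$, and define the modulated energy $$\mathcal L_\varepsilon[f_\varepsilon]:=H_Q(f_\varepsilon)+\frac{\varepsilon^2}{2}\int_{\mathbb T}(\partial_xV_\varepsilon)^2\,dx.$$ Then $\mathcal L_\varepsilon$ is a Lyapunov functional in the sense that $$\forall t\in\mathbb R^+,\qquad \mathcal L_\varepsilon[f_\varepsilon(t)]=\mathcal L_\varepsilon[f_{0,\varepsilon}].$$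
   Context: $\mathbb T=\mathbb R/\mathbb Z$. Standing assumptions: $f_{0,\varepsilon}\in L^1(\mathbb T\times\mathbb R)$, $f_{0,\varepsilon}\ge0$, $\int f_{0,\varepsilon}\,dv\,dx=1$, and the initial energy $\mathcal E_\varepsilon[f_{0,\varepsilon}]$ is finite, where $\mathcal E_\varepsilon[f]=\frac12\int f|v|^2\,dv\,dx+\frac{\varepsilon^2}{2}\int|\partial_xV_\varepsilon[f]|^2dx$. Solutions are global strong solutions; for them the energy is preserved, and so is $\int Q(f_\varepsilon)\,dx\,dv$ for any continuous function $Q$. $S$-stable profile: $\mu:\mathbb R\to\mathbb R^+$ with $\int\mu\,dv=1$ such that (i) $\mu$ is continuous; (ii) $\int\mu(v)v^2dv<\infty$; (iii) there is $\bar v\in\mathbb R$ such that $\mu$ is increasing for $v<\bar v$ and decreasing for $v>\bar v$, so $\mu$ reaches its unique maximum at $\bar v$; (iv) $\mu(2\bar v-v)=\mu(v)$ for all $v$. Then there is a unique continuous increasing $\varphi:(-\infty,0]\to\mathbb R^+$ with $\mu(v)=\varphi(-\frac{|v-\bar v|^2}2)$ and $\int_{-\infty}^0\varphi(u)\sqrt{-u}\,du<\infty$. Admissible $Q$ and Casimir functional: $Q:\mathbb R^+\to\mathbb R$ satisfies $Q(0)=0$, $Q'=\varphi^{-1}$ on the range of $\varphi$; outside this range the only condition is that $Q'$ is increasing and continuous, so that $Q$ is globally convex and $C^1$ on $\mathbb R^+$. Then $$H_Q(f):=\int_{\mathbb T\times\mathbb R}\bigl(Q(f)-Q(\mu)-Q'(\mu)(f-\mu)\bigr)\,dv\,dx\in[0,+\infty].$$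 At time $0$, $V_\varepsilon$ in $\mathcal L_\varepsilon[f_{0,\varepsilon}]$ is the potential given by the Poisson equation with density $\int f_{0,\varepsilon}\,dv$. *)

(* Defs.v *)
From mathcomp Require Import all_boot all_order all_algebra.
From mathcomp Require Import all_classical all_reals all_analysis.

Set Implicit Arguments.
Unset Strict Implicit.
Unset Printing Implicit Defensive.

Import Order.TTheory GRing.Theory Num.Theory.
Import numFieldNormedType.Exports.

Local Open Scope classical_set_scope.
Local Open Scope ring_scope.

(* The torus R/Z is handled through 1-periodic functions of a real variable,  *)
(* integrated over the fundamental domain [0, 1]. A phase-space point is a    *)
(* pair z = (x, v).                                                           *)

Notation leb := lebesgue_measure.
Notation leb2 := (lebesgue_measure \x lebesgue_measure)%E.

Definition phase (R : realType) : set (R * R) := `[0, 1]%classic `*` setT.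

Definition periodic_x (R : realType) (f : R * R -> R) : Prop :=
  forall v : R, periodic (fun x : R => f (x, v)) 1.

Definition dx (R : realType) (psi : R * R -> R) (z : R * R) : R :=
  derive1 (fun x : R => psi (x, z.2)) z.1.

Definition dv (R : realType) (psi : R * R -> R) (z : R * R) : R :=
  derive1 (fun v : R => psi (z.1, v)) z.2.

Record test_function (R : realType) (psi : R * R -> R) : Prop := {
  test_periodic : periodic_x psi;
  test_supp : exists M : R, forall z, M < `|z.2| -> psi z = 0;
  test_derivable_x : forall z, derivable (fun x : R => psi (x, z.2)) z.1 1;
  test_derivable_v : forall z, derivable (fun v : R => psi (z.1, v)) z.2 1;
  test_continuous : continuous psi;
  test_continuous_dx : continuous (dx psi);
  test_continuous_dv : continuous (dv psi)
}.

Definition density (R : realType) (f : R * R -> R) (x : R) : R :=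
  \int[leb]_v f (x, v).

(* - eps ^ 2 V'' = density f - 1 on the torus. As the density is only in L^1, *)
(* V is C^1 with an absolutely continuous derivative, and the equation is     *)
(* stated in integrated form.                                                 *)
Record poisson (R : realType) (eps : R) (f : R * R -> R) (V : R -> R) : Prop := {
  poisson_periodic : periodic V 1;
  poisson_derivable : forall x : R, derivable V x 1;
  poisson_eq : forall a b : R, a <= b ->
    - (eps ^+ 2) * (derive1 V b - derive1 V a) = \int[leb]_(y in `[a, b]) (density f y - 1)
}.

Definition field_energy (R : realType) (eps : R) (V : R -> R) : \bar R :=
  ((eps ^+ 2 / 2)%:E * \int[leb]_(x in `[0%R, 1%R]) ((derive1 V x) ^+ 2)%:E)%E.

Definition energy (R : realType) (eps : R) (f : R * R -> R) (V : R -> R) : \bar R :=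
  ((2^-1)%:E * \int[leb2]_(z in @phase R) (f z * `|z.2| ^+ 2)%:E
   + field_energy eps V)%E.

Record initial_datum (R : realType) (eps : R) (f0 : R * R -> R) (V0 : R -> R)
    : Prop := {
  init_periodic : periodic_x f0;
  init_ge0 : forall z, 0 <= f0 z;
  init_integrable : leb2.-integrable (@phase R) (EFin \o f0);
  init_mass : (\int[leb2]_(z in @phase R) (f0 z)%:E = 1)%E;
  init_poisson : poisson eps f0 V0;
  init_energy : (energy eps f0 V0 < +oo)%E
}.

(* Global strong solutions, for initial data that are merely in L^1: f is in  *)
(* C([0, +oo[; L^1), the Vlasov equation, in the conservative form            *)
(* d_t f + d_x (v f) - d_v (f d_x V) = 0, holds for every t > 0 against test  *)
(* functions of (x, v), and the total energy and the integrals of all         *)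
(* continuous functions of f are preserved. The preservation properties are   *)
(* what tells these solutions from general distributional ones.               *)
Record strong_solution (R : realType) (eps : R) (f0 : R * R -> R)
    (f : R -> R * R -> R) (V : R -> R -> R) : Prop := {
  sol_periodic : forall t : R, 0 <= t -> periodic_x (f t);
  sol_ge0 : forall (t : R) z, 0 <= t -> 0 <= f t z;
  sol_integrable : forall t : R, 0 <= t ->
    leb2.-integrable (@phase R) (EFin \o f t);
  sol_continuous : forall t : R, 0 <= t ->
    (\int[leb2]_(z in @phase R) (`|f s z - f t z|)%:E)%E
      @[s --> within [set s | 0 <= s] (nbhs t)] --> 0%E;
  sol_initial : {ae leb2, forall z, f 0 z = f0 z};
  sol_poisson : forall t : R, 0 <= t -> poisson eps (f t) (V t);
  sol_vlasov : forall psi, test_function psi -> forall t : R, 0 < t ->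
    is_derive t 1
      (fun s : R => \int[leb2]_(z in @phase R) (f s z * psi z) : R)
      (\int[leb2]_(z in @phase R)
         (f t z * (z.2 * dx psi z - derive1 (V t) z.1 * dv psi z)));
  sol_energy : forall t : R, 0 <= t -> energy eps (f t) (V t) = energy eps (f 0) (V 0);
  sol_casimir : forall G : R -> R, {within `[0, +oo[, continuous G} ->
    forall t : R, 0 <= t ->
    (\int[leb2]_(z in @phase R) (G (f t z))%:E
     = \int[leb2]_(z in @phase R) (G (f 0 z))%:E)%E
}.

Record S_stable (R : realType) (mu : R -> R) (vbar : R) : Prop := {
  stable_ge0 : forall v, 0 <= mu v;
  stable_mass : (\int[leb]_v (mu v)%:E = 1)%E;
  stable_continuous : continuous mu;
  stable_moment2 : (\int[leb]_v (mu v * v ^+ 2)%:E < +oo)%E;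
  stable_increasing : forall v w : R, v < w -> w < vbar -> mu v < mu w;
  stable_decreasing : forall v w : R, vbar < v -> v < w -> mu w < mu v;
  stable_symmetric : forall v, mu (2 * vbar - v) = mu v
}.

(* Only the restriction of phi to ]-oo, 0] matters. *)
Record profile_function (R : realType) (mu : R -> R) (vbar : R) (phi : R -> R)
    : Prop := {
  profile_ge0 : forall u : R, u <= 0 -> 0 <= phi u;
  profile_continuous : {within `]-oo, 0], continuous phi};
  profile_increasing : forall u w : R, u < w -> w <= 0 -> phi u < phi w;
  profile_eq : forall v, mu v = phi (- (`|v - vbar| ^+ 2 / 2));
  profile_moment :
    (\int[leb]_(u in `]-oo, 0%R]) (phi u * Num.sqrt (- u))%:E < +oo)%E
}.

(* Q' = phi^-1 tends to -oo at 0, so Q is C^1 on ]0, +oo[ and, at 0, only     *)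
(* continuous (as r * ln r for a Maxwellian profile).                         *)
Record admissible (R : realType) (phi Q : R -> R) : Prop := {
  adm_0 : Q 0 = 0;
  adm_continuous : {within `[0, +oo[, continuous Q};
  adm_derivable : forall r : R, 0 < r -> derivable Q r 1;
  adm_derive_continuous : forall r : R, 0 < r -> {for r, continuous (derive1 Q)};
  adm_derive_increasing : forall r s : R, 0 < r -> r <= s -> derive1 Q r <= derive1 Q s;
  adm_inverse : forall u : R, u <= 0 -> derive1 Q (phi u) = u
}.

Definition casimir_functional (R : realType) (mu Q : R -> R) (f : R * R -> R)
    : \bar R :=
  (\int[leb2]_(z in @phase R)
     (Q (f z) - Q (mu z.2) - derive1 Q (mu z.2) * (f z - mu z.2))%:E)%E.

Definition modulated_energy (R : realType) (eps : R) (mu Q : R -> R)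
    (f : R * R -> R) (V : R -> R) : \bar R :=
  (casimir_functional mu Q f + field_energy eps V)%E.

(* Main.v *)
Require Import Defs.
From mathcomp Require Import all_boot all_order all_algebra.
From mathcomp Require Import all_classical all_reals all_analysis.
From mathcomp Require Import measurable_realfun.
From mathcomp Require Import ring lra.
Import Order.TTheory GRing.Theory Num.Theory.
Import numFieldNormedType.Exports.
Local Open Scope classical_set_scope.
Local Open Scope ring_scope.
Set Implicit Arguments.
Unset Strict Implicit.
Unset Printing Implicit Defensive.

(** Along the flow the Casimir integrals and the total energy are conserved, so
the identity rests on two points: momentum is conserved as well, and the
Casimir functional can be expanded although its terms need not be integrable.

Since Q'(mu) = - w with w(v) = |v - vbar|^2 / 2, the integrand of H_Q is the
Bregman divergence Q(f) - Q(mu) + w (f - mu). Formally H_Q(f) is therefore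
the integral of Q(f), plus the integral of w f, plus a constant depending on mu
alone. The first term is conserved. Expanding the square, the second is the
kinetic energy minus vbar times the momentum plus vbar^2 / 2 times the mass;
with the field energy it adds up to the conserved total energy, as soon as the
momentum is conserved.

To make the expansion rigorous without any integrability of Q(f) or Q(mu), Q is
replaced by a truncation G_n (trunc_casimir) that is nonnegative, continuous
and vanishes below the level phi(- n); the weight w becomes min(w, n). For two
densities f and g of equal mass and equal Casimir integrals, the expansion can
then be arranged with nonnegative terms only, those to be cancelled having
finite integral, so that f and g can be exchanged. The truncated divergences stay below the Bregman
divergence and converge to it pointwise; Fatou's lemma yields
H_Q(f) + int w g <= H_Q(g) + int w f (casimir_kinetic_le), and the reverse
inequality by symmetry.

For the momentum, the Vlasov equation is tested against a compactly supported
cutoff of v at scale 1 / a. Its time derivative is minus the integral of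
f V' cutoff', where cutoff' - 1 = O(a^2 v^2). The field is bounded in terms of
the mass (field_bound) and the second velocity moment is bounded by the energy,
so the error is O(a^2); the leading term, the integral of f V', vanishes because
a periodic self-consistent field exerts no total force (Rintegral_force0). The
mean value inequality and a -> 0 conclude (momentum_conserved).

The solution at time 0 agrees with the initial datum only almost everywhere;
this determines the field, since the density determines V' up to a constant and
V' has zero mean (ae_eq_field). *)

(** * Convexity of the Casimir function and the profile *)

(** The derivative of Q may tend to - oo at 0, so the tangent is only taken at
positive points; the base point r = 0 is reached through the continuity of Q
there. *)
Lemma tangent_below (R : realType) (phi Q : R -> R) (r s : R) :
  admissible phi Q -> 0 < s -> 0 <= r -> Q s + derive1 Q s * (r - s) <= Q r.
Proof.
move=> adm s0 r0.
have mvt a b : 0 <= a -> a < b ->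
    exists2 c, c \in `]a, b[%R & Q b - Q a = derive1 Q c * (b - a).
  move=> a0 ab; apply: MVT => //.
  - move=> x; rewrite in_itv /= => /andP[ax _].
    have x0 : 0 < x by exact: le_lt_trans a0 ax.
    by apply: DeriveDef; [exact: adm_derivable adm _ x0|rewrite derive1E].
  - apply: continuous_subspaceW (adm_continuous adm) => x /=.
    by rewrite !in_itv/= andbT => /andP[ax _]; exact: le_trans a0 ax.
have [rs|sr|->] := ltgtP r s; last by rewrite subrr mulr0 addr0.
- have [c + e] := mvt _ _ r0 rs; rewrite in_itv/= => /andP[rc cs].
  have : derive1 Q c <= derive1 Q s.
    by apply: (adm_derive_increasing adm); [exact: le_lt_trans rc|exact: ltW].
  by move: e rs; nra.
- have [c + e] := mvt _ _ (ltW s0) sr; rewrite in_itv/= => /andP[sc cr].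
  have : derive1 Q s <= derive1 Q c.
    by apply: (adm_derive_increasing adm) => //; exact: ltW.
  by move: e sr; nra.
Qed.

Section profile.
Context {R : realType} (mu phi : R -> R) (vbar : R).
Hypothesis mu_stable : S_stable mu vbar.
Hypothesis mu_phi : profile_function mu vbar phi.

(** phi(u - 1) is nonnegative and phi is strictly increasing. *)
Lemma profile_gt0 (u : R) : u <= 0 -> 0 < phi u.
Proof.
move=> u0; apply: (@le_lt_trans _ _ (phi (u - 1))).
  by apply: (profile_ge0 mu_phi); lra.
by apply: (profile_increasing mu_phi) => //; lra.
Qed.

Lemma profile_le (u w : R) : u <= w -> w <= 0 -> phi u <= phi w.
Proof.
move=> uw w0; have [->//|uNw] := eqVneq u w.
by apply/ltW/(profile_increasing mu_phi); rewrite ?lt_neqAle ?uNw.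
Qed.

(** Otherwise phi, hence mu, would be bounded below by a positive constant, and
mu would have infinite mass. *)
Lemma profile_cvg0 (e : R) : 0 < e ->
  exists N : nat, forall n, (N <= n)%N -> phi (- n%:R) < e.
Proof.
move=> e0; apply: contrapT => /forallNP noN.
have phie (u : R) : u <= 0 -> e <= phi u.
  move=> u0; have [N uN] : exists N : nat, - u < N%:R.
    by exists (Num.truncn (- u)).+1; rewrite truncnS_gt.
  have /existsNP[n /not_implyP[Nn /negP]] := noN N; rewrite -leNgt => en.
  apply: le_trans en _; apply: profile_le => //.
  by rewrite lerNl; apply: ltW; apply: lt_le_trans uN _; rewrite ler_nat.
have : (\int[leb]_(v in setT) (e%:E) <= \int[leb]_v (mu v)%:E)%E.
  apply: ge0_le_integral => //.
  - by move=> x _; rewrite lee_fin ltW.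
  - apply/measurable_EFinP.
    exact: continuous_measurable_fun (stable_continuous mu_stable).
  - by move=> v _; rewrite lee_fin (profile_eq mu_phi) phie.
rewrite (stable_mass mu_stable) [leLHS](integral_cst leb measurableT e%:E).
rewrite [X in (_ * X)%E](_ : _ = +oo%E); last first.
  by have := @lebesgue_measure_itv R `]-oo, +oo[; rewrite set_itvNyy.
by rewrite gt0_muley // lte_fin.
Qed.
End profile.

(** * Truncated Bregman divergences *)

(** This is Q(max(r, d)) minus the tangent of Q at d = phi(- n), where Q' = - n;
equivalently, the primitive vanishing at 0 of max(Q', - n) + n. *)
Definition trunc_casimir (R : realType) (phi Q : R -> R) (n : nat) (r : R) : R :=
  let d := phi (- n%:R) in
  Q (Num.max r d) - Q d + n%:R * (Num.max r d - d).

Definition kinetic (R : realType) (vbar v : R) : R := `|v - vbar| ^+ 2 / 2.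

Definition bregman (R : realType) (Q : R -> R) (r s : R) : R :=
  Q r - Q s - derive1 Q s * (r - s).

(** The Bregman divergence of [trunc_casimir] at mu(v): there the derivative of
the truncation is max(Q'(mu v), - n) + n = max(n - w(v), 0). *)
Definition trunc_bregman (R : realType) (phi Q mu : R -> R) (vbar : R) (n : nat)
    (r v : R) : R :=
  trunc_casimir phi Q n r - trunc_casimir phi Q n (mu v)
  - Num.max (n%:R - kinetic vbar v) 0 * (r - mu v).

Section truncation.
Context {R : realType} (mu phi Q : R -> R) (vbar : R).
Hypothesis mu_stable : S_stable mu vbar.
Hypothesis mu_phi : profile_function mu vbar phi.
Hypothesis Q_adm : admissible phi Q.
Local Notation w := (kinetic vbar).
Local Notation G := (trunc_casimir phi Q).
Local Notation h n := (trunc_bregman phi Q mu vbar n).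

Lemma kinetic_ge0 (v : R) : 0 <= w v.
Proof. by rewrite /kinetic divr_ge0. Qed.

Lemma mu_kinetic (v : R) : mu v = phi (- w v).
Proof. exact: profile_eq mu_phi v. Qed.

Lemma mu_gt0 (v : R) : 0 < mu v.
Proof. by rewrite mu_kinetic (profile_gt0 mu_phi) // oppr_le0 kinetic_ge0. Qed.

Lemma derive1_casimir_mu (v : R) : derive1 Q (mu v) = - w v.
Proof. by rewrite mu_kinetic (adm_inverse Q_adm) // oppr_le0 kinetic_ge0. Qed.

Let level_gt0 (n : nat) : 0 < phi (- n%:R).
Proof. by rewrite (profile_gt0 mu_phi) // oppr_le0. Qed.

Let derive1_level (n : nat) : derive1 Q (phi (- n%:R)) = - n%:R.
Proof. by rewrite (adm_inverse Q_adm) // oppr_le0. Qed.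

Lemma trunc_casimir_ge0 (n : nat) (r : R) : 0 <= G n r.
Proof.
have d0 := level_gt0 n; rewrite /trunc_casimir /=.
have m0 : 0 <= Num.max r (phi (- n%:R)) by rewrite le_max (ltW d0) orbT.
have := tangent_below Q_adm d0 m0; rewrite derive1_level; lra.
Qed.

(** Q decreases on the range of mu, so only the linear part n (r - d) of the
truncation counts; this makes the integral of the truncation at mu finite. *)
Lemma trunc_casimir_mu_le (n : nat) (v : R) : G n (mu v) <= n%:R * mu v.
Proof.
have d0 := level_gt0 n; have m0 := mu_gt0 v.
have w0 := kinetic_ge0 v; have n0 : 0 <= n%:R :> R by [].
rewrite /trunc_casimir /=; case: (ltP (mu v) (phi (- n%:R))) => md; first by nra.
have := tangent_below Q_adm m0 (ltW d0); rewrite derive1_casimir_mu; nra.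
Qed.

Lemma bregman_ge0 (r v : R) : 0 <= r -> 0 <= bregman Q r (mu v).
Proof.
by move=> r0; have := tangent_below Q_adm (mu_gt0 v) r0; rewrite /bregman; lra.
Qed.

(** At velocities not truncated by n, the two divergences differ only by what Q
does below the level phi(- n). *)
Lemma trunc_bregmanE (n : nat) (r v : R) : w v <= n%:R ->
  bregman Q r (mu v) - h n r v =
  if r < phi (- n%:R) then bregman Q r (phi (- n%:R)) else 0.
Proof.
move=> wn; rewrite /bregman /trunc_bregman /trunc_casimir.
rewrite derive1_casimir_mu derive1_level /=.
have dmu : phi (- n%:R) <= mu v.
  by rewrite mu_kinetic (profile_le mu_phi) ?lerN2 // oppr_le0 kinetic_ge0.
rewrite (max_idPl dmu) (max_idPl (_ : 0 <= n%:R - w v)) ?subr_ge0 //.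
case: ifPn => [rd|]; first by rewrite (max_idPr (ltW rd)); ring.
by rewrite -leNgt => dr; rewrite (max_idPl dr); ring.
Qed.

Lemma trunc_bregman_low (n : nat) (r v : R) : n%:R < w v -> h n r v = G n r.
Proof.
move=> nw; rewrite /trunc_bregman (max_idPr (_ : n%:R - w v <= 0)); last by lra.
have mud : mu v <= phi (- n%:R).
  by rewrite mu_kinetic (profile_le mu_phi) ?lerN2 ?(ltW nw) // oppr_le0.
by rewrite {2}/trunc_casimir /= (max_idPr mud); ring.
Qed.

(** Truncating Q' at - n contracts its variations, and the divergence is the
integral of such variations between mu and r. *)
Lemma trunc_bregman_le (n : nat) (r v : R) : 0 <= r -> h n r v <= bregman Q r (mu v).
Proof.
move=> r0; have d0 := level_gt0 n; have [wn|nw] := leP (w v) n%:R.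
  rewrite -subr_ge0 trunc_bregmanE //; case: ifPn => // _.
  by have := tangent_below Q_adm d0 r0; rewrite /bregman; lra.
rewrite trunc_bregman_low // /trunc_casimir /=.
have [rd|dr] := leP r (phi (- n%:R)).
  by rewrite (_ : _ + _ = 0); [exact: bregman_ge0|ring].
have := tangent_below Q_adm (mu_gt0 v) (ltW d0).
rewrite /bregman derive1_casimir_mu; nra.
Qed.

Lemma trunc_bregman_ge0 (n : nat) (r v : R) : 0 <= r -> 0 <= h n r v.
Proof.
move=> r0; have d0 := level_gt0 n; have [wn|nw] := leP (w v) n%:R; last first.
  by rewrite trunc_bregman_low // trunc_casimir_ge0.
have dmu : phi (- n%:R) <= mu v.
  by rewrite mu_kinetic (profile_le mu_phi) ?lerN2 // oppr_le0 kinetic_ge0.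
rewrite /trunc_bregman /trunc_casimir /=.
rewrite (max_idPl dmu) (max_idPl (_ : 0 <= n%:R - w v)) ?subr_ge0 //.
have m0 : 0 <= Num.max r (phi (- n%:R)) by rewrite le_max r0.
have rm : r <= Num.max r (phi (- n%:R)) by rewrite le_max lexx.
have := tangent_below Q_adm (mu_gt0 v) m0; rewrite derive1_casimir_mu; nra.
Qed.

(** The levels phi(- n) tend to 0. If r > 0 they eventually pass below r and the
truncation is exact; if r = 0 the gap is at most - Q(phi(- n)), which tends to
0 by continuity of Q at 0. *)
Lemma trunc_bregman_cvg (r v : R) : 0 <= r ->
  h n r v @[n --> \oo] --> bregman Q r (mu v).
Proof.
move=> r0; apply/cvgrPdist_le => e e0.
have [N1 wN1] : exists N : nat, w v < N%:R.
  by exists (Num.truncn (w v)).+1; rewrite truncnS_gt.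
have [d d0 dQ] : exists2 d : R, 0 < d & forall s, 0 <= s -> s < d -> `|Q s| <= e.
  have := adm_continuous Q_adm; move=> /continuous_within_itvcyP[_].
  move=> /cvgrPdist_le/(_ _ e0); rewrite (adm_0 Q_adm) => -[/= d d0 Hd].
  exists d => // s; rewrite le_eqVlt => /predU1P[<- _|s0 sd].
    by rewrite (adm_0 Q_adm) normr0 ltW.
  have := Hd s; rewrite /= sub0r normrN => /(_ _ s0); rewrite sub0r normrN; apply.
  by rewrite gtr0_norm.
(* Once phi(- n) < d', the gap is zero if r > 0, and at most e if r = 0. *)
pose d' := if r == 0 then d else r.
have d'0 : 0 < d' by rewrite /d'; case: eqVneq => // rN0; rewrite lt_neqAle eq_sym rN0.
have [N2 phiN2] := profile_cvg0 mu_stable mu_phi d'0.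
exists (maxn N1 N2) => // n /=; rewrite geq_max => /andP[N1n N2n].
rewrite trunc_bregmanE; last by apply: (le_trans (ltW wN1)); rewrite ler_nat.
have := phiN2 n N2n; rewrite /d'; have [r00|rN0] := eqVneq r 0.
  rewrite r00 level_gt0 => pd.
  have := dQ _ (ltW (level_gt0 n)) pd.
  have := tangent_below Q_adm (level_gt0 n) (lexx 0).
  have := level_gt0 n; have n0 : 0 <= n%:R :> R by [].
  rewrite /bregman derive1_level (adm_0 Q_adm) => p0 T.
  rewrite !ler_norml => /andP[? ?]; apply/andP; split; nra.
by move=> pr; rewrite ltNge (ltW pr) /= normr0 ltW.
Qed.

Lemma trunc_casimir_continuous (n : nat) : {within `[0, +oo[, continuous (G n)}.
Proof.
apply: continuous_subspaceT => r.
have d0 := level_gt0 n.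
have cm : {for r, continuous (fun r => Num.max r (phi (- n%:R)))}.
  by apply: continuous_max; [exact: cvg_id|exact: cvg_cst].
apply: cvgD.
  apply: cvgB; last exact: cvg_cst.
  apply: (@continuous_comp _ _ _ (fun r => Num.max r (phi (- n%:R))) Q) => //.
  apply: differentiable_continuous; apply/derivable1_diffP.
  by apply: (adm_derivable Q_adm); rewrite lt_max d0 orbT.
by apply: cvgM; [exact: cvg_cst|apply: cvgB; [exact: cm|exact: cvg_cst]].
Qed.

End truncation.

(** * Integration over phase space *)

Lemma lebesgue_measure_unit (R : realType) :
  (leb (`[0%R, 1%R]%classic : set R) = 1)%E.
Proof.
by have := @lebesgue_measure_itv R `[0%R, 1%R]; rewrite /= lte_fin ltr01 oppr0 adde0.
Qed.

Section phase.
Context {R : realType}.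
Local Notation P := (@phase R).
Local Open Scope ereal_scope.

Lemma measurable_phase : measurable P.
Proof. by apply: measurableX. Qed.

Lemma measurable_phase_v (F : R -> R) :
  measurable_fun setT F -> measurable_fun P (fun z => F z.2).
Proof.
move=> mF; apply: measurableT_comp => //.
exact: (measurable_funS measurableT (@subsetT _ _) measurable_snd).
Qed.

Lemma integral_phase_v (F : R -> R) :
  measurable_fun setT F -> (forall v, 0 <= F v)%R ->
  \int[leb2]_(z in P) (F z.2)%:E = \int[leb]_v (F v)%:E.
Proof.
move=> mF F0; rewrite integral_mkcond fubini_tonelli2 /=; first last.
- by move=> z; rewrite patchE; case: ifPn => // _; rewrite lee_fin.
- apply/(measurable_restrictT _ measurable_phase).
  by apply/measurable_EFinP; exact: measurable_phase_v.
apply: eq_integral => v _; rewrite /fubini_G.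
transitivity (\int[leb]_(x in `[0%R, 1%R]) (F v)%:E).
  rewrite [RHS]integral_mkcond; apply: eq_integral => x _.
  rewrite !patchE; congr (if _ then _ else _).
  by apply/idP/idP; rewrite !inE /phase => //= -[].
rewrite [LHS](integral_cst leb _ (F v)%:E) //.
by rewrite [X in _ * X](_ : _ = 1) ?mule1 //; exact: lebesgue_measure_unit.
Qed.

Lemma measurable_phase_comp (F : R -> R) (f : R * R -> R) :
  {within `[0%R, +oo[%classic, continuous F} ->
  (forall z, 0 <= f z)%R -> measurable_fun P f ->
  measurable_fun P (F \o f).
Proof.
move=> cF f0 mf; refine (@measurable_comp _ _ _ _ _ _
  (`[0%R, +oo[%classic : set R) F P f _ _ _ mf) => //.
- by move=> _ [z _ <-]; rewrite /= in_itv /= f0.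
- exact: subspace_continuous_measurable_fun.
Qed.
End phase.

(** * Exchanging two densities with equal Casimir integrals *)

Section casimir.
Context {R : realType} (mu phi Q : R -> R) (vbar : R).
Hypothesis mu_stable : S_stable mu vbar.
Hypothesis mu_phi : profile_function mu vbar phi.
Hypothesis Q_adm : admissible phi Q.
Local Notation P := (@phase R).
Local Notation w := (kinetic vbar).
Local Notation G := (trunc_casimir phi Q).
Local Notation h n := (trunc_bregman phi Q mu vbar n).
Local Open Scope ereal_scope.

Lemma measurable_mu : measurable_fun P (fun z : R * R => mu z.2).
Proof.
by apply: measurable_phase_v; exact: continuous_measurable_fun (stable_continuous mu_stable).
Qed.

Lemma measurable_kinetic : measurable_fun P (fun z : R * R => w z.2).
Proof.
apply: measurable_phase_v; apply: measurable_funM => //.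
apply: measurable_funX; apply: measurableT_comp => //.
by apply: measurable_funB.
Qed.

Let measurable_G n (a : R * R -> R) : (forall z, 0 <= a z)%R ->
  measurable_fun P a -> measurable_fun P (fun z => G n (a z)).
Proof.
move=> a0 ma; apply: (@measurable_phase_comp _ (G n)) => //.
exact: (trunc_casimir_continuous mu_phi Q_adm).
Qed.

Let mu0 z : (0 <= mu z)%R := ltW (mu_gt0 mu_phi z).

Let measurable_h n (a : R * R -> R) : (forall z, 0 <= a z)%R ->
  measurable_fun P a -> measurable_fun P (fun z => h n (a z) z.2).
Proof.
move=> a0 ma; have mmu := measurable_mu; have mw := measurable_kinetic.
apply: measurable_funB; last first.
  apply: measurable_funM; last exact: measurable_funB.
  by apply: measurable_maxr => //; exact: measurable_funB.
by apply: measurable_funB; apply: measurable_G.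
Qed.

Lemma measurable_bregman (a : R * R -> R) : (forall z, 0 <= a z)%R ->
  measurable_fun P a -> measurable_fun P (fun z => bregman Q (a z) (mu z.2)).
Proof.
move=> a0 ma; apply: measurable_fun_cvg.
  by move=> n; exact: (measurable_h n a0 ma).
by move=> z _; exact: (trunc_bregman_cvg mu_stable mu_phi Q_adm).
Qed.

Section two_densities.
Variables (f g : R * R -> R).
Hypotheses (f0 : forall z, (0 <= f z)%R) (g0 : forall z, (0 <= g z)%R).
Hypotheses (mf : measurable_fun P f) (mg : measurable_fun P g).
Hypothesis mass : \int[leb2]_(z in P) (f z)%:E = \int[leb2]_(z in P) (g z)%:E.
Hypothesis mass_fin : \int[leb2]_(z in P) (f z)%:E < +oo.
Hypothesis equi : forall n,
  \int[leb2]_(z in P) (G n (f z))%:E = \int[leb2]_(z in P) (G n (g z))%:E.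

Let truncw n (z : R * R) : R := Num.min (w z.2) n%:R.

Let measurable_truncw n : measurable_fun P (truncw n).
Proof. by apply: measurable_minr => //; exact: measurable_kinetic. Qed.

Let truncw0 n z : (0 <= truncw n z)%R.
Proof. by rewrite /truncw le_min kinetic_ge0 /=. Qed.

Let intD (a b : R * R -> R) : measurable_fun P a -> measurable_fun P b ->
  (forall z, 0 <= a z)%R -> (forall z, 0 <= b z)%R ->
  \int[leb2]_(z in P) (a z + b z)%:E =
  \int[leb2]_(z in P) (a z)%:E + \int[leb2]_(z in P) (b z)%:E.
Proof.
move=> ma mb a0 b0; under eq_integral do rewrite EFinD.
rewrite ge0_integralD //; first exact: measurable_phase.
all: by [move=> z _; rewrite lee_fin|exact/measurable_EFinP].
Qed.

(* The expansion of the truncated divergence, with every subtracted term moved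
to the other side, so that only nonnegative functions are integrated. *)
Let trunc_expansion (a b : R * R -> R) n :
  (forall z, 0 <= a z)%R -> (forall z, 0 <= b z)%R ->
  measurable_fun P a -> measurable_fun P b ->
  \int[leb2]_(z in P) (h n (a z) z.2 + truncw n z * b z)%:E +
  (n%:R%:E * \int[leb2]_(z in P) (a z)%:E + \int[leb2]_(z in P) (G n (mu z.2))%:E) =
  \int[leb2]_(z in P) (G n (a z))%:E + (
  \int[leb2]_(z in P) (Num.max (n%:R - w z.2) 0 * mu z.2)%:E +
  \int[leb2]_(z in P) (truncw n z * a z + truncw n z * b z)%:E).
Proof.
move=> a0 b0 ma mb; have mmu := measurable_mu; have mw := measurable_kinetic.
have mh := measurable_h n a0 ma; have mt := measurable_truncw n.
have n0 : (0 <= n%:R :> R)%R by [].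
have Gm0 z := trunc_casimir_ge0 mu_phi Q_adm n z.
have mG := measurable_G n a0 ma.
have mGmu : measurable_fun P (fun z : R * R => G n (mu z.2)) by apply: measurable_G.
have h0 z : (0 <= h n (a z) z.2)%R by exact: (trunc_bregman_ge0 mu_phi Q_adm).
have mmax : measurable_fun P (fun z : R * R => Num.max (n%:R - w z.2) 0)%R.
  by apply: measurable_maxr => //; exact: measurable_funB.
have max0 (z : R * R) : (0 <= Num.max (n%:R - w z.2) 0)%R by rewrite le_max lexx orbT.
have -> : n%:R%:E * \int[leb2]_(z in P) (a z)%:E = \int[leb2]_(z in P) (n%:R * a z)%:E.
  under [RHS]eq_integral do rewrite EFinM.
  rewrite ge0_integralZl_EFin //; first exact: measurable_phase.
  - by move=> z _; rewrite lee_fin.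
  - exact/measurable_EFinP.
rewrite -!intD //; first last.
all: try by [apply: measurable_funM|move=> z; rewrite ?addr_ge0 ?mulr_ge0].
all: try by [do ?[apply: measurable_funD => // | apply: measurable_funM => //]].
all: try by [move=> z; apply: addr_ge0 => //; exact: mulr_ge0].
apply: eq_integral => z _; congr (_%:E).
have maxE : (Num.max (n%:R - w z.2) 0 = n%:R - truncw n z :> R)%R.
  rewrite /truncw; have [wn|nw] := leP (w z.2) n%:R.
    by rewrite (max_idPl _) // subr_ge0.
  by rewrite subrr (max_idPr _) // subr_le0 ltW.
by rewrite /trunc_bregman maxE; ring.
Qed.

(* In trunc_expansion the right-hand side is symmetric in the two densities up to
their Casimir integral, and what is added on the left is finite. *)
Let trunc_exchange n :
  \int[leb2]_(z in P) (h n (f z) z.2 + truncw n z * g z)%:E =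
  \int[leb2]_(z in P) (h n (g z) z.2 + truncw n z * f z)%:E.
Proof.
have := trunc_expansion n f0 g0 mf mg.
have -> : \int[leb2]_(z in P) (truncw n z * f z + truncw n z * g z)%:E
        = \int[leb2]_(z in P) (truncw n z * g z + truncw n z * f z)%:E.
  by apply: eq_integral => z _; rewrite addrC.
rewrite equi -(trunc_expansion n g0 f0 mg mf) mass.
set c := (X in _ + X = _) => /(congr1 (fun u => u - c)).
suff cfin : c \is a fin_num by rewrite !addeK.
have mmu := measurable_mu.
have mGmu : measurable_fun P (fun z : R * R => G n (mu z.2)) by apply: measurable_G.
rewrite ge0_fin_numE /c.
  rewrite lte_add_pinfty // -?mass ?lte_mul_pinfty ?lee_fin //.
  apply: (@le_lt_trans _ _ (\int[leb2]_(z in P) (n%:R * mu z.2)%:E)).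
    apply: ge0_le_integral.
    - exact: measurable_phase.
    - by move=> z _; rewrite lee_fin (trunc_casimir_ge0 mu_phi Q_adm).
    - exact/measurable_EFinP.
    - by apply/measurable_EFinP; exact: measurable_funM.
    - by move=> z _; rewrite lee_fin (trunc_casimir_mu_le mu_phi Q_adm).
  rewrite (@integral_phase_v _ (fun v => n%:R * mu v)%R); last by move=> v; rewrite mulr_ge0.
    under eq_integral do rewrite EFinM.
    rewrite ge0_integralZl_EFin // ?(stable_mass mu_stable) ?mule1 ?ltry //.
    - by move=> v _; rewrite lee_fin.
    - by apply/measurable_EFinP; exact: continuous_measurable_fun (stable_continuous mu_stable).
  by apply: measurable_funM => //; exact: continuous_measurable_fun (stable_continuous mu_stable).
rewrite adde_ge0 ?mule_ge0 ?lee_fin // integral_ge0 // => z _; rewrite lee_fin //.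
exact: (trunc_casimir_ge0 mu_phi Q_adm).
Qed.

(** In the expansions of H_Q(f) and H_Q(g) the Casimir integrals and the
terms depending on mu alone agree, so that only the kinetic integrals
differ. Both sides may be infinite, whence the crosswise form, without
subtraction. *)
Lemma casimir_kinetic_le :
  casimir_functional mu Q f + \int[leb2]_(z in P) (w z.2 * g z)%:E <=
  casimir_functional mu Q g + \int[leb2]_(z in P) (w z.2 * f z)%:E.
Proof.
have mmu := measurable_mu; have mw := measurable_kinetic.
have mB := measurable_bregman.
have B0 (a : R * R -> R) z : (forall z, 0 <= a z)%R -> (0 <= bregman Q (a z) (mu z.2))%R.
  by move=> a0; exact: (bregman_ge0 mu_phi Q_adm).
rewrite /casimir_functional -!intD //;
  try by [exact: mB|move=> z; exact: B0|exact: measurable_funM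
         |move=> z; rewrite mulr_ge0 ?kinetic_ge0].
pose F n z := (h n (f z) z.2 + truncw n z * g z)%:E.
have -> : \int[leb2]_(z in P) (bregman Q (f z) (mu z.2) + w z.2 * g z)%:E
    = \int[leb2]_(z in P) limn_einf (F ^~ z).
  apply: eq_integral => z _; apply/esym/(cvg_limn_einf_sup _).1.
  apply: cvg_EFin; first exact: nearW.
  apply: cvgD; first exact: (trunc_bregman_cvg mu_stable mu_phi Q_adm).
  apply: cvgM; last exact: cvg_cst.
  apply: (cvg_near_cst (w z.2)).
  exists (Num.truncn (w z.2)).+1 => // n /= wn; apply/min_idPl.
  by apply: (le_trans (ltW (truncnS_gt _))); rewrite ler_nat.
apply: (le_trans (fatou leb2 measurable_phase (f := F) _ _)).
- move=> n; apply/measurable_EFinP; apply: measurable_funD; first exact: measurable_h.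
  by apply: measurable_funM; [exact: measurable_truncw|exact: mg].
- by move=> n z _; rewrite lee_fin addr_ge0 ?mulr_ge0 // (trunc_bregman_ge0 mu_phi Q_adm).
rewrite limn_einf_lim; apply: lime_le; first exact: is_cvg_einfs.
near=> n; apply: (@le_trans _ _ (\int[leb2]_(z in P) F n z)).
  by apply: ereal_inf_lbound; exists n => /=.
rewrite /F trunc_exchange; apply: ge0_le_integral.
- exact: measurable_phase.
- by move=> z _; rewrite lee_fin addr_ge0 ?mulr_ge0 // (trunc_bregman_ge0 mu_phi Q_adm).
- apply/measurable_EFinP; apply: measurable_funD; first exact: measurable_h.
  by apply: measurable_funM; [exact: measurable_truncw|exact: mf].
- by apply/measurable_EFinP; apply: measurable_funD; [exact: mB|exact: measurable_funM].
- move=> z _; rewrite lee_fin lerD ?(trunc_bregman_le mu_phi Q_adm) //.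
  by rewrite ler_wpM2r // ge_min lexx.
Unshelve. all: by end_near. Qed.
End two_densities.
End casimir.

(** * The spatial density *)

Section bounded_product.
Context d (T : measurableType d) (R : realType) (m : {measure set T -> \bar R}).
Variables (D : set T) (mD : measurable D).

Lemma integrableM_bounded (f h : T -> R) (C : R) :
  m.-integrable D (EFin \o f) -> measurable_fun D h ->
  (forall x, D x -> `|h x| <= C) ->
  m.-integrable D (fun x => (f x * h x)%:E).
Proof.
move=> fi mh hC; have mf := measurable_int _ fi.
apply: (@le_integrable _ _ _ _ _ mD _ (fun x => (C%:E * (EFin \o f) x)%E)).
- by apply/measurable_EFinP; apply: measurable_funM => //; exact/measurable_EFinP.
- move=> x Dx; rewrite /= lee_fin !normrM [leRHS]mulrC ler_wpM2l //.
  exact: le_trans (hC _ Dx) (ler_norm _).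
- exact: integrableZl.
Qed.

End bounded_product.

Section density.
Context {R : realType}.
Local Notation P := (@phase R).
Local Notation I01 := (`[0%R, 1%R]%classic : set R).

Section fubini_density.
Variable g : R * R -> R.
Hypothesis ig : leb2.-integrable P (EFin \o g).

Let gP := (EFin \o g) \_ P.

Let igP : leb2.-integrable setT gP.
Proof. exact: (integrable_mkcond (mu := leb2) (EFin \o g) measurable_phase).1 ig. Qed.

Let F := fubini_F leb gP.

Let FE x : I01 x -> F x = (\int[leb]_v (g (x, v))%:E)%E.
Proof.
move=> Ix; apply: eq_integral => v _; rewrite /gP patchE ifT //.
by rewrite inE.
Qed.

Let F0 x : ~ I01 x -> F x = 0%E.
Proof.
move=> Ix; rewrite /F /fubini_F; apply: integral0_eq => v _.
rewrite /gP patchE ifF //.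
by apply/negP; rewrite inE => -[].
Qed.

Let iF : leb.-integrable setT F := integrable_fubini_F igP.

Let densityE x : I01 x -> density g x = fine (F x).
Proof. by move=> Ix; rewrite FE. Qed.

Let mdensity : measurable_fun I01 (density g).
Proof.
apply: (@eq_measurable_fun _ _ _ _ _ (fine \o F)).
  by move=> x; rewrite inE => Ix; rewrite densityE.
apply: measurable_funTS; apply: measurableT_comp => //.
exact: measurable_int iF.
Qed.

Lemma integrable_density : leb.-integrable I01 (EFin \o density g).
Proof.
apply: (@le_integrable _ _ _ leb I01 _ (EFin \o density g) F) => //.
- exact/measurable_EFinP.
- move=> x Ix /=; rewrite densityE //.
  by case: (F x) => [r||] //=; rewrite ?leey // normr0 leey.
- exact: integrableS iF.
Qed.

Lemma Rintegral_density : \int[leb]_(x in I01) density g x = \int[leb2]_(z in P) g z.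
Proof.
rewrite /Rintegral; congr fine.
transitivity (\int[leb]_(x in I01) F x)%E.
  apply: ae_eq_integral => //.
  - exact/measurable_EFinP.
  - by apply: measurable_funTS; exact: measurable_int iF.
  - have := integrable_ae measurableT iF; apply: filterS => x /(_ I) Fx Ix.
    by rewrite densityE // fineK.
rewrite [LHS]integral_mkcond [RHS]integral_mkcond -(integral12_prod_meas1 igP).
apply: eq_integral => x _; rewrite patchE; case: ifPn => //.
by rewrite notin_setE => nx; exact/esym/F0.
Qed.
End fubini_density.

(** This holds at every x, even where f(x, .) is not integrable: both sides are
then 0, because an infinite integral has real part 0. *)
Lemma density_mull (f : R * R -> R) (h : R -> R) (x : R) :
  (forall z, 0 <= f z) -> measurable_fun P f -> I01 x ->
  density (fun z => f z * h z.1) x = density f x * h x.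
Proof.
move=> f0 mf Ix; rewrite /density /= /Rintegral.
have mfx : measurable_fun setT (fun v => f (x, v)).
  apply: (@measurable_comp _ _ _ _ _ _ P) => //.
  - exact: measurable_phase.
  - by move=> _ [v _ <-].
have ge0 c : 0 <= c ->
    (\int[leb]_v (f (x, v) * c)%:E = c%:E * \int[leb]_v (f (x, v))%:E)%E.
  move=> c0; under eq_integral do rewrite mulrC EFinM.
  rewrite ge0_integralZl_EFin //; last exact/measurable_EFinP.
  by move=> v _; rewrite lee_fin.
have fineMl c (y : \bar R) : (0 <= y)%E -> fine (c%:E * y)%E = fine y * c.
  case: y => [r _|_|//]; first by rewrite /= mulrC.
  rewrite [X in _ = X * _]/= mul0r.
  have [c0|c0|->] := ltgtP c 0; last by rewrite mul0e.
  - by rewrite lt0_muley // lte_fin.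
  - by rewrite gt0_muley // lte_fin.
have If0 : (0 <= \int[leb]_v (f (x, v))%:E)%E.
  by apply: integral_ge0 => v _; rewrite lee_fin.
have [h0|h0] := leP 0 (h x); first by rewrite ge0 // fineMl.
under eq_integral do rewrite -(opprK (h x)) mulrN EFinN.
rewrite integral_ge0N; last by move=> v _; rewrite lee_fin mulr_ge0 // oppr_ge0 ltW.
by rewrite ge0 ?oppr_ge0 ?(ltW h0) // fineN fineMl // mulrN opprK.
Qed.

(** With T x the integral of g up to x, this is the integral of T' T, that is
T(+oo)^2 / 2 = 0. As g is merely integrable, the proof exchanges the order of
integration in g(x) g(y) over the half-plane y <= x: since g has integral 0,
the exchanged integral is the opposite of the original one. *)
Lemma Rintegral_triangle (g : R -> R) : leb.-integrable setT (EFin \o g) ->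
  \int[leb]_x g x = 0 ->
  \int[leb]_x (g x * \int[leb]_(y in `]-oo, x]) g y) = 0.
Proof.
move=> ig g0.
have mg : measurable_fun setT g by apply/measurable_EFinP; exact: measurable_int ig.
pose k z := (g z.1 * g z.2 * (z.2 <= z.1)%R%:R)%:E.
have mk : measurable_fun setT k.
  apply/measurable_EFinP; apply: measurable_funM.
    by apply: measurable_funM; apply: measurableT_comp.
  rewrite (_ : (fun _ => _) = (\1_[set z : R * R | z.2 <= z.1])).
    apply: measurable_indic.
    rewrite -[X in measurable X]setTI.
    exact: (measurable_fun_ler measurable_snd measurable_fst).
  by apply/funext => z; rewrite indicE mem_setE.
have isub (D : set R) : measurable D -> leb.-integrable setT (EFin \o (g \_ D)).
  move=> mD; rewrite -restrict_EFin.
  apply: (integrable_mkcond (mu := leb) (EFin \o g) mD).1.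
  exact: integrableS ig.
have k1 x y : k (x, y) = (g x * (g \_ `]-oo, x]) y)%:E.
  by rewrite /k /= patchE mem_setE /= in_itv /=; case: leP => _; rewrite ?mulr1 // !mulr0.
have k2 x y : k (x, y) = (g y * (g \_ `[y, +oo[) x)%:E.
  rewrite /k /= patchE mem_setE /= in_itv /= andbT.
  by case: leP => _; rewrite ?mulr1 ?mulr0 // mulrC.
have Ek (D : set R) c : measurable D ->
    (\int[leb]_y (c * (g \_ D) y)%:E = (c * \int[leb]_(y in D) g y)%:E)%E.
  move=> mD; rewrite Rintegral_mkcond -RintegralZl //; last exact: isub.
  rewrite fineK //; apply: integrable_fin_num => //.
  exact: (@integrableZl _ _ _ leb setT measurableT c _ (isub _ mD)).
have ik : leb2.-integrable setT k.
  apply/integrable12ltyP => //.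
  apply: (@le_lt_trans _ _ (\int[leb]_x \int[leb]_y (`|g x| * `|g y|)%:E)%E).
    apply: ge0_le_integral => //.
    - by move=> x _; apply: integral_ge0.
    - apply: (measurable_fun_fubini_tonelli_F (m2 := leb) (abse \o k)).
      + exact: measurableT_comp.
      + by move=> z; exact: abse_ge0.
    - apply: (measurable_fun_fubini_tonelli_F (m2 := leb)
        (fun z => (`|g z.1| * `|g z.2|)%:E)).
      + apply/measurable_EFinP; apply: measurable_funM.
          by apply: measurableT_comp => //; apply: measurableT_comp.
        by apply: measurableT_comp => //; apply: measurableT_comp.
      + by move=> z; rewrite lee_fin mulr_ge0.
    - move=> x _; apply: ge0_le_integral => //.
      + by apply: measurableT_comp => //; apply: measurableT_comp.
      + by apply/measurable_EFinP; apply: measurable_funM => //; apply: measurableT_comp.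
      + move=> y _; rewrite /k /= lee_fin !normrM.
        by rewrite ler_piMr ?mulr_ge0 // normr_nat lern1 leq_b1.
  have ign := integrable_norm ig.
  have En c : (\int[leb]_y (c * `|g y|)%:E = (c * \int[leb]_y `|g y|)%:E)%E.
    rewrite -RintegralZl // fineK //; apply: integrable_fin_num => //.
    exact: (@integrableZl _ _ _ leb setT measurableT c _ ign).
  under eq_integral do rewrite En mulrC.
  by rewrite En ltry.
have := Fubini ik.
under eq_integral do under eq_integral do rewrite k1.
under eq_integral do rewrite Ek //.
under [RHS]eq_integral do under eq_integral do rewrite k2.
under [RHS]eq_integral do rewrite Ek //.
set T := fun x => \int[leb]_(y in `]-oo, x]) g y.
have ST y : \int[leb]_(x in `[y, +oo[) g x = - T y.
  have := @Rintegral_itvB R g -oo%O +oo%O y; rewrite set_itvNyy => /(_ ig isT isT).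
  rewrite g0 sub0r /T => ->; rewrite Rintegral_itv_obnd_cbnd //.
  exact: integrableS ig.
under [RHS]eq_integral do rewrite ST mulrN EFinN.
move=> /(congr1 fine).
have iT : leb.-integrable setT (fun x => (g x * T x)%:E).
  have := integrable_fubini_F ik; rewrite /fubini_F.
  by under eq_fun do (under eq_integral do rewrite k1; rewrite Ek //).
rewrite -[X in _ = fine X]/(\int[leb]_x (\- (fun x => (g x * T x)%:E)) x)%E.
have -> : (\int[leb]_x (- (g x * T x)%:E) = - \int[leb]_x (g x * T x)%:E)%E.
  by rewrite -integralN //; exact: integrable_add_def.
rewrite fineN /Rintegral => /eqP; rewrite -addr_eq0 -mulr2n mulrn_eq0 /= => /eqP; exact.
Qed.

End density.

(** * The self-consistent field *)

Section poisson_field.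
Context {R : realType}.
Variables (eps : R) (f : R * R -> R) (V : R -> R).
Local Notation P := (@phase R).
Local Notation I01 := (`[0%R, 1%R]%classic : set R).
Hypotheses (eps_gt0 : 0 < eps) (f0 : forall z, 0 <= f z).
Hypothesis fi : leb2.-integrable P (EFin \o f).
Hypothesis mass : \int[leb2]_(z in P) f z = 1.
Hypothesis fV : poisson eps f V.

Let rho := density f.
Let charge x := rho x - 1.
Let V' : R -> R := derive1 V.

Let e2_gt0 : 0 < eps ^+ 2. Proof. exact: exprn_gt0. Qed.

Let i1 : leb.-integrable I01 (EFin \o cst (1 : R)).
Proof.
apply: continuous_compact_integrable; first exact: segment_compact.
by apply: continuous_subspaceT => x; exact: cvg_cst.
Qed.

Let icharge : leb.-integrable I01 (EFin \o charge).
Proof.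
rewrite (_ : _ \o _ = (EFin \o rho) \- (EFin \o cst (1%R : R)))%E //.
by apply: integrableB => //; exact: integrable_density.
Qed.

Let one01 : \int[leb]_(x in I01) (cst 1 x) = 1 :> R.
Proof.
by rewrite Rintegral_cst // mul1r; exact: (congr1 fine (lebesgue_measure_unit R)).
Qed.

Let charge0 : \int[leb]_(x in I01) charge x = 0.
Proof.
rewrite RintegralB //; last exact: integrable_density.
by rewrite Rintegral_density // mass one01 subrr.
Qed.

(* Over a period, the integral of |rho - 1| is at most 1 + 1. *)
Let field_incr a b : 0 <= a -> a <= b -> b <= 1 ->
  eps ^+ 2 * `|V' b - V' a| <= 2.
Proof.
move=> a0 ab b1.
have -> : eps ^+ 2 * `|V' b - V' a| = `|- (eps ^+ 2) * (V' b - V' a)|.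
  by rewrite normrM normrN (gtr0_norm e2_gt0).
have sub : `[a, b] `<=` I01.
  move=> x /=; rewrite !in_itv /= => /andP[ax xb].
  by rewrite (le_trans a0 ax) (le_trans xb b1).
rewrite (poisson_eq fV ab); apply: (le_trans (le_normr_Rintegral _ _)) => //.
  exact: integrableS icharge.
have -> : (2 : R) = \int[leb]_(x in I01) (rho x + cst 1 x).
  rewrite RintegralD //; last exact: integrable_density.
  by rewrite Rintegral_density // mass one01; ring.
have irho1 : leb.-integrable I01 (fun x => (rho x + 1)%:E).
  rewrite (_ : (fun _ => _) = (EFin \o rho) \+ (EFin \o cst (1%R : R)))%E //.
  by apply: integrableD => //; exact: integrable_density.
have rho0 x : 0 <= rho x by apply: Rintegral_ge0.
apply: (@le_trans _ _ (\int[leb]_(x in `[a, b]) (rho x + 1))).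
  apply: le_Rintegral => //.
  - by apply: integrable_norm; exact: integrableS icharge.
  - exact: integrableS irho1.
  - by move=> x _; rewrite ler_norml -/(rho x); have := rho0 x => rx; apply/andP; split; lra.
rewrite /Rintegral fine_le //.
- by apply: integrable_fin_num => //; exact: integrableS irho1.
- exact: integrable_fin_num.
- apply: ge0_subset_integral => //; first exact: measurable_int irho1.
  by move=> x _; rewrite lee_fin addr_ge0.
Qed.

Let V_continuous : continuous V.
Proof.
move=> x; apply: differentiable_continuous; apply/derivable1_diffP.
exact: poisson_derivable fV x.
Qed.

(** The field vanishes somewhere, by Rolle's theorem applied to the periodic
potential; its variation from there is controlled by the charge. *)
Lemma field_bound x : I01 x -> `|V' x| <= 2 / eps ^+ 2.
Proof.
rewrite /= in_itv /= => /andP[x0 x1].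
have [|||c c01 dc] := Rolle (@ltr01 R) (f := V).
- by move=> y _; exact: poisson_derivable fV y.
- exact: continuous_subspaceT.
- by have := poisson_periodic fV 0; rewrite add0r.
have Vc : V' c = 0 by rewrite /V' derive1E; case: dc.
move: c01; rewrite in_itv /= => /andP[/ltW c0 /ltW c1].
rewrite ler_pdivlMr // mulrC.
have [xc|cx] := leP x c.
  by have := field_incr x0 xc c1; rewrite Vc sub0r normrN.
by have := field_incr c0 (ltW cx) x1; rewrite Vc subr0.
Qed.

Lemma field_eq x : I01 x ->
  V' x = V' 0 - (eps ^+ 2)^-1 * \int[leb]_(y in `[0, x]) charge y.
Proof.
rewrite /= in_itv /= => /andP[x0 x1].
rewrite -(poisson_eq fV x0) -/V'; field.
by rewrite gt_eqF.
Qed.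

Lemma field_continuous : {within I01, continuous V'}.
Proof.
have := parameterized_integral_continuous (@ler01 R) icharge.
move=> /subspace_continuousP c; apply/subspace_continuousP => x Ix.
rewrite /from_subspace [X in _ --> X](field_eq Ix).
have FE : {in I01, V' =1 fun y =>
    V' 0 - (eps ^+ 2)^-1 * \int[leb]_(z in `[0, y]) charge z}.
  by move=> y; rewrite inE => /field_eq.
apply: (cvg_trans (fmap_within_eq _ FE)).
have cF := c x Ix.
by apply: cvgB; [exact: cvg_cst|apply: cvgM; [exact: cvg_cst|exact: cF]].
Qed.

Lemma measurable_field : measurable_fun I01 V'.
Proof. by apply: subspace_continuous_measurable_fun => //; exact: field_continuous. Qed.

Lemma Rintegral_field0 : \int[leb]_(x in I01) V' x = 0.
Proof.
rewrite /Rintegral (continuous_FTC2 (F := V) ltr01 field_continuous) //.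
- by have := poisson_periodic fV 0; rewrite add0r => ->; rewrite -EFinB subrr.
- split.
  + by move=> x _; exact: poisson_derivable fV x.
  + by apply: cvg_at_right_filter; exact: V_continuous.
  + by apply: cvg_at_left_filter; exact: V_continuous.
Qed.

Lemma measurable_phase_field : measurable_fun P (fun z => V' z.1).
Proof.
apply: (@measurable_comp _ _ _ _ _ _ I01 V' P fst) => //.
- by move=> _ [z [z1 _] <-].
- exact: measurable_field.
- exact: (measurable_funS measurableT (@subsetT _ _) measurable_fst).
Qed.

(** Write f's density as 1 plus the charge. The constant part contributes the
mean of V', which is zero; the charge is - eps^2 V'', and the product V'' V' has
zero integral because V' takes the same value at both ends, the total charge
being zero. *)
Lemma Rintegral_force0 : \int[leb2]_(z in P) (f z * V' z.1) = 0.
Proof.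
have mf : measurable_fun P f by apply/measurable_EFinP; exact: measurable_int fi.
have ifV : leb2.-integrable P (EFin \o (fun z => f z * V' z.1)).
  apply: (integrableM_bounded (m := leb2) (C := 2 / eps ^+ 2)
    measurable_phase fi measurable_phase_field).
  by move=> z [z1 _]; exact: field_bound.
rewrite -(Rintegral_density ifV).
have iV' : leb.-integrable I01 (EFin \o V').
  by apply: continuous_compact_integrable; [exact: segment_compact|exact: field_continuous].
have igV : leb.-integrable I01 (fun x => (charge x * V' x)%:E).
  apply: (integrableM_bounded (m := leb) (C := 2 / eps ^+ 2) _ icharge measurable_field) => //.
  exact: field_bound.
transitivity (\int[leb]_(x in I01) (charge x * V' x + V' x)).
  apply: eq_Rintegral => x; rewrite inE => Ix.
  by rewrite density_mull // /charge -/rho; ring.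
rewrite RintegralD // Rintegral_field0 addr0.
pose g := charge \_ I01.
have ig : leb.-integrable setT (EFin \o g).
  by rewrite -restrict_EFin; apply: (integrable_mkcond (mu := leb) (EFin \o charge) _).1.
have ig0 : \int[leb]_x g x = 0 by rewrite -Rintegral_mkcond.
have tri : \int[leb]_(x in I01) (charge x * \int[leb]_(y in `[0, x]) charge y) = 0.
  rewrite Rintegral_mkcond; apply: etrans (Rintegral_triangle ig ig0).
  apply: eq_Rintegral => x _.
  have gx : g x = if x \in I01 then charge x else 0 by rewrite /g patchE.
  rewrite gx patchE; case: ifPn => [|_]; last by rewrite mul0r.
  rewrite inE /= in_itv /= => /andP[x0 x1]; rewrite -Rintegral_mkcondr.
  congr (_ * Rintegral _ _ _); apply/seteqP; split => y /=; rewrite !in_itv /=.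
    by move=> /andP[-> yx]; rewrite yx (le_trans yx x1).
  by move=> [-> /andP[-> _]].
transitivity (\int[leb]_(x in I01) (V' 0 * charge x -
    (eps ^+ 2)^-1 * (charge x * \int[leb]_(y in `[0, x]) charge y))).
  by apply: eq_Rintegral => x; rewrite inE => Ix; rewrite {1}field_eq //; ring.
have chE x : I01 x -> charge x * \int[leb]_(y in `[0, x]) charge y =
    (eps ^+ 2) * (V' 0 * charge x - charge x * V' x).
  by move=> Ix; rewrite (field_eq Ix); field; rewrite gt_eqF.
have ich : leb.-integrable I01
    (EFin \o (fun x => charge x * \int[leb]_(y in `[0, x]) charge y)).
  have mI : measurable I01 by [].
  apply: (eq_integrable (mu := leb) mI
    (fun x => ((eps ^+ 2)%:E * ((V' 0)%:E * (charge x)%:E - (charge x * V' x)%:E))%E)).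
    by move=> x; rewrite inE => Ix; rewrite /= chE.
  by apply: integrableZl => //; apply: integrableB => //; exact: integrableZl.
rewrite RintegralB //; first last.
- exact: (integrableZl (mu := leb) _ (eps ^+ 2)^-1 ich).
- exact: (integrableZl (mu := leb) _ (V' 0) icharge).
rewrite !RintegralZl // charge0 mulr0 sub0r.
by rewrite tri mulr0 oppr0.
Qed.
End poisson_field.

(** * A compactly supported cutoff of the velocity *)

Section cutoff.
Context {R : realType}.
Implicit Types (a v u : R).

(** The square of [bump] is continuously differentiable, is 1 + O(a^2 v^2), and
vanishes for |v| > 1 / a: a smoother cutoff would bring nothing, as test
functions are only C^1. *)
Definition bump a v : R := Num.max (1 - (a * v) ^+ 2) 0.
Definition cutoff a v : R := v * bump a v ^+ 2.
Definition cutoff' a v : R := bump a v ^+ 2 - 4 * (a * v) ^+ 2 * bump a v.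

Lemma maxr0_sqr_taylor u (h : R) :
  `|Num.max (h + u) 0 ^+ 2 - Num.max u 0 ^+ 2 - 2 * Num.max u 0 * h| <= h ^+ 2.
Proof.
rewrite ler_norml.
have [hu|hu] := leP (h + u) 0; have [u0|u0] := leP u 0; apply/andP; split; nra.
Qed.

Lemma is_derive_maxr0_sqr u :
  is_derive u 1 (fun u : R => Num.max u 0 ^+ 2) (2 * Num.max u 0).
Proof.
have H : (fun h : R =>
    h^-1 *: (Num.max (h *: 1 + u) 0 ^+ 2 - Num.max u 0 ^+ 2)) @ 0^' --> 2 * Num.max u 0.
  apply/cvgrPdist_le => e e0; near=> h.
  have h0 : h != 0 by near: h; exact: nbhs_dnbhs_neq.
  apply: (@le_trans _ _ `|h|); last by near: h; exact: dnbhs0_le.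
  rewrite distrC -(ler_pM2r (_ : 0 < `|h|)) ?normr_gt0 // -[leLHS]normrM.
  rewrite [X in `|X|](_ : _ = Num.max (h + u) 0 ^+ 2 - Num.max u 0 ^+ 2
    - 2 * Num.max u 0 * h).
    by rewrite -expr2 real_normK ?num_real //; exact: maxr0_sqr_taylor.
  by rewrite /GRing.scale /= mulr1; field.
by apply: DeriveDef; [apply/cvg_ex; exists (2 * Num.max u 0)|apply: cvg_lim].
Unshelve. all: by end_near. Qed.

Lemma is_derive_cutoff a v : is_derive v 1 (cutoff a) (cutoff' a v).
Proof.
have dq : is_derive v 1 (fun v : R => 1 - (a * v) ^+ 2) (- (2 * (a * v) * a)).
  by apply: is_derive_eq; rewrite /GRing.scale /=; ring.
have db := @is_derive1_comp R (fun u => Num.max u 0 ^+ 2) (fun v => 1 - (a * v) ^+ 2)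
  v _ _ (is_derive_maxr0_sqr _) dq.
have dm := @is_deriveM _ _ id _ v 1 _ _ (is_derive_id v 1) db.
apply: is_derive_eq; rewrite /GRing.scale /= /cutoff' /bump; ring.
Qed.

Let cvg_sqr (F : set_system R) {FF : Filter F} (f : R -> R) (l : R) :
  f @ F --> l -> (fun x => f x ^+ 2) @ F --> l ^+ 2.
Proof. by move=> fl; rewrite expr2; under eq_fun do rewrite expr2; exact: cvgM. Qed.

Lemma bump_continuous a : continuous (bump a).
Proof.
move=> v.
have : {for v, continuous (fun v => Num.max (1 - (a * v) ^+ 2) 0)}; last by [].
apply: continuous_max; last exact: cvg_cst.
by apply: cvgB; [exact: cvg_cst|apply: cvg_sqr; apply: cvgM; [exact: cvg_cst|exact: cvg_id]].
Qed.

Lemma cutoff_continuous a : continuous (cutoff a).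
Proof. by move=> v; apply: cvgM; [exact: cvg_id|apply: cvg_sqr; exact: bump_continuous]. Qed.

Lemma cutoff'_continuous a : continuous (cutoff' a).
Proof.
move=> v; apply: cvgB; first by apply: cvg_sqr; exact: bump_continuous.
apply: cvgM; last exact: bump_continuous.
apply: cvgM; first exact: cvg_cst.
by apply: cvg_sqr; apply: cvgM; [exact: cvg_cst|exact: cvg_id].
Qed.

(** The obvious error bound a^2 |v|^3 would involve the third moment of f. As
|1 - bump^2| <= 1 as well, one power of a |v| can be given up, and the second
moment suffices. *)
Lemma cutoff_dist a v : 0 <= a -> `|cutoff a v - v| <= 2 * a * v ^+ 2.
Proof.
move=> a0; have -> : cutoff a v - v = v * (bump a v ^+ 2 - 1) by rewrite /cutoff; ring.
rewrite normrM.
have : `|bump a v ^+ 2 - 1| <= 2 * (a * `|v|).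
  rewrite /bump exprMn -(real_normK (num_real v)) -exprMn.
  have : 0 <= a * `|v| by rewrite mulr_ge0.
  move: (a * `|v|) => u u0; rewrite ler_norml.
  by have [hu|hu] := leP (1 - u ^+ 2) 0; apply/andP; split; nra.
have := normr_ge0 v; rewrite -(real_normK (num_real v)).
by move: `|v| `|_| => x y; nra.
Qed.

Lemma cutoff'_dist a v : `|cutoff' a v - 1| <= 6 * a ^+ 2 * v ^+ 2.
Proof.
have -> : 6 * a ^+ 2 * v ^+ 2 = 6 * (a * v) ^+ 2 by ring.
rewrite /cutoff' /bump ler_norml.
have := sqr_ge0 (a * v); move: ((a * v) ^+ 2) => s s0.
by have [hs|hs] := leP (1 - s) 0; apply/andP; split; nra.
Qed.

Lemma cutoff_bound a v : 0 < a -> `|cutoff a v| <= a^-1.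
Proof.
move=> a0; rewrite -(ler_pM2r a0) mulVf ?gt_eqF // -{2}(gtr0_norm a0) -normrM.
have -> : cutoff a v * a = (a * v) * bump a v ^+ 2 by rewrite /cutoff; ring.
rewrite /bump; move: (a * v) => u; rewrite ler_norml.
have [hs|hs] := leP (1 - u ^+ 2) 0; first by apply/andP; split; nra.
have /andP[u1 u2] : -1 <= u <= 1.
  by rewrite -ler_norml -(@expr_le1 _ 2) // -normrX ger0_norm ?sqr_ge0 //; lra.
have q1 : (1 - u ^+ 2) ^+ 2 <= 1.
  by rewrite expr_le1 //; [have := sqr_ge0 u; lra|exact: ltW].
have := sqr_ge0 (1 - u ^+ 2).
by move: {hs} ((1 - u ^+ 2) ^+ 2) q1 => q q1 q0; apply/andP; split; nra.
Qed.

Lemma cutoff_supp a v : 0 < a -> a^-1 < `|v| -> cutoff a v = 0.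
Proof.
move=> a0 av; rewrite /cutoff /bump (max_idPr _) ?expr0n ?mulr0 //.
have : 1 < a * `|v| by rewrite mulrC -ltr_pdivrMr // div1r.
rewrite exprMn -(real_normK (num_real v)) -exprMn; nra.
Qed.

Lemma dx_snd (F : R -> R) : dx (fun z : R * R => F z.2) = fun=> 0.
Proof. by apply/funext => z; rewrite /dx /= derive1_cst. Qed.

Lemma dv_cutoff a : dv (fun z : R * R => cutoff a z.2) = fun z => cutoff' a z.2.
Proof.
apply/funext => z; rewrite /dv /= derive1E.
by have := is_derive_cutoff a z.2 => d; rewrite derive_val.
Qed.

Lemma test_function_cutoff a : 0 < a -> test_function (fun z : R * R => cutoff a z.2).
Proof.
move=> a0; split.
- by move=> v x.
- by exists a^-1 => z; exact: cutoff_supp.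
- by move=> z; exact: (derivable_cst (cutoff a z.2)).
- by move=> z; have [] := is_derive_cutoff a z.2.
- by move=> z; apply: continuous_comp; [exact: cvg_snd|exact: cutoff_continuous].
- by rewrite dx_snd => z; exact: cvg_cst.
- rewrite dv_cutoff => z; apply: continuous_comp; first exact: cvg_snd.
  exact: cutoff'_continuous.
Qed.
End cutoff.

(** * Conservation of momentum *)

Section moments.
Context {R : realType}.
Local Notation P := (@phase R).
Variables (f : R * R -> R).
Hypothesis f0 : forall z, 0 <= f z.
Hypothesis fi : leb2.-integrable P (EFin \o f).
Hypothesis moment2 : (\int[leb2]_(z in P) (f z * `|z.2| ^+ 2)%:E < +oo)%E.

Let mf : measurable_fun P f.
Proof. by apply/measurable_EFinP; exact: measurable_int fi. Qed.

Lemma measurable_v : measurable_fun P (fun z : R * R => z.2).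
Proof. exact: (@measurable_phase_v _ id). Qed.

Lemma integrable_moment2 : leb2.-integrable P (EFin \o (fun z => f z * z.2 ^+ 2)).
Proof.
apply/integrableP; split.
  apply/measurable_EFinP; apply: measurable_funM => //.
  by apply: measurable_funX; exact: measurable_v.
apply: le_lt_trans moment2; rewrite le_eqVlt; apply/orP; left; apply/eqP.
apply: eq_integral => z _ /=; congr (_%:E).
by rewrite real_normK ?num_real // ger0_norm // mulr_ge0 ?sqr_ge0.
Qed.

Lemma integrable_moment1 : leb2.-integrable P (EFin \o (fun z => f z * z.2)).
Proof.
apply: (@le_integrable _ _ _ leb2 P measurable_phase _
  ((EFin \o f) \+ (EFin \o (fun z => f z * z.2 ^+ 2)%R))%E).
- by apply/measurable_EFinP; apply: measurable_funM => //; exact: measurable_v.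
- move=> z _ /=; rewrite lee_fin normrM (ger0_norm (f0 z)) [leRHS]ger0_norm.
    have -> : f z + f z * z.2 ^+ 2 = f z * (1 + z.2 ^+ 2) by ring.
    rewrite ler_wpM2l // -(real_normK (num_real z.2)).
    by move: `|_| => y; nra.
  by apply: addr_ge0; [exact: f0|apply: mulr_ge0; [exact: f0|exact: sqr_ge0]].
- exact: (integrableD (mu := leb2) measurable_phase fi integrable_moment2).
Qed.

Lemma Rintegral_moment2 : \int[leb2]_(z in P) (f z * z.2 ^+ 2) =
  fine (\int[leb2]_(z in P) (f z * `|z.2| ^+ 2)%:E)%E.
Proof.
congr fine; apply: eq_integral => z _; congr (_%:E).
by rewrite real_normK ?num_real.
Qed.

End moments.

Section momentum.
Context {R : realType}.
Local Notation P := (@phase R).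
Variables (eps : R) (f0 : R * R -> R) (f : R -> R * R -> R) (V : R -> R -> R).
Hypothesis eps_gt0 : 0 < eps.
Hypothesis sol : strong_solution eps f0 f V.
Variable K : R.
Hypothesis mass : forall t : R, 0 <= t -> \int[leb2]_(z in P) f t z = 1.
Hypothesis moment2 : forall t : R, 0 <= t ->
  (\int[leb2]_(z in P) (f t z * `|z.2| ^+ 2)%:E <= K%:E)%E.

Let m2fin t : 0 <= t -> (\int[leb2]_(z in P) (f t z * `|z.2| ^+ 2)%:E < +oo)%E.
Proof. by move=> t0; apply: le_lt_trans (moment2 t0) (ltry _). Qed.

Let ft0 t z : 0 <= t -> 0 <= f t z. Proof. exact: sol_ge0 sol t z. Qed.
Let fti t : 0 <= t -> leb2.-integrable P (EFin \o f t).
Proof. exact: sol_integrable sol t. Qed.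

Let im2 t : 0 <= t -> leb2.-integrable P (EFin \o (fun z => f t z * z.2 ^+ 2)).
Proof.
move=> t0; apply: integrable_moment2; [|exact: fti|exact: m2fin].
by move=> z; exact: ft0.
Qed.

Let im1 t : 0 <= t -> leb2.-integrable P (EFin \o (fun z => f t z * z.2)).
Proof.
move=> t0; apply: integrable_moment1; [|exact: fti|exact: m2fin].
by move=> z; exact: ft0.
Qed.

Let m2K t : 0 <= t -> \int[leb2]_(z in P) (f t z * z.2 ^+ 2) <= K.
Proof.
move=> t0; rewrite Rintegral_moment2 -lee_fin fineK; first exact: moment2.
rewrite ge0_fin_numE ?m2fin //; apply: integral_ge0 => z _.
by rewrite lee_fin mulr_ge0 ?sqr_ge0 ?ft0.
Qed.

Let mcutoff a : measurable_fun P (fun z : R * R => cutoff a z.2).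
Proof.
apply: measurable_phase_v; apply: continuous_measurable_fun.
exact: cutoff_continuous.
Qed.

Let mcutoff' a : measurable_fun P (fun z : R * R => cutoff' a z.2).
Proof.
apply: measurable_phase_v; apply: continuous_measurable_fun.
exact: cutoff'_continuous.
Qed.

Let icutoff (a t : R) : 0 < a -> 0 <= t ->
  leb2.-integrable P (fun z => (f t z * cutoff a z.2)%:E).
Proof.
move=> a0 t0.
apply: (integrableM_bounded (m := leb2) (C := a^-1)
  measurable_phase (fti t0) (mcutoff a)).
by move=> z _; exact: cutoff_bound.
Qed.

Lemma cutoff_momentum_dist (a t : R) : 0 < a -> 0 <= t ->
  `|\int[leb2]_(z in P) (f t z * cutoff a z.2) -
    \int[leb2]_(z in P) (f t z * z.2)| <= 2 * a * K.
Proof.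
move=> a0 t0; have mP := measurable_phase (R := R).
rewrite -RintegralB //; [|exact: icutoff|exact: im1].
have iB : leb2.-integrable P (EFin \o (fun z => f t z * cutoff a z.2 - f t z * z.2)).
  by apply: (integrableB (mu := leb2) mP (icutoff a0 t0) (im1 t0)).
apply: (le_trans (le_normr_Rintegral _ iB)) => //.
apply: (@le_trans _ _ (\int[leb2]_(z in P) (2 * a * (f t z * z.2 ^+ 2)))).
  apply: le_Rintegral => //.
  - exact: integrable_norm iB.
  - exact: (integrableZl (mu := leb2) mP (2 * a) (im2 t0)).
  - move=> z _; rewrite -mulrBr normrM ger0_norm ?ft0 //.
    by rewrite mulrCA ler_wpM2l ?ft0 // cutoff_dist // ltW.
rewrite RintegralZl //; last exact: im2.
by rewrite ler_wpM2l ?m2K // mulr_ge0 // ltW.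
Qed.

(** The total force being zero, only the part of it seen by 1 - cutoff' remains,
and this is quadratic in a v. *)
Lemma cutoff_momentum_derivative (a t : R) : 0 < a -> 0 < t ->
  exists2 D : R,
    is_derive t 1 (fun s : R => \int[leb2]_(z in P) (f s z * cutoff a z.2)) D &
    `|D| <= (2 / eps ^+ 2) * (6 * a ^+ 2 * K).
Proof.
move=> a0 t0; have t0' := ltW t0; have mP := measurable_phase (R := R).
have := sol_vlasov sol (test_function_cutoff a0) t0.
rewrite dx_snd dv_cutoff => dF; eexists; first exact: dF.
set V' := derive1 (V t).
have ft00 z : 0 <= f t z by exact: ft0.
have fV := sol_poisson sol t0'.
have mV := measurable_phase_field eps_gt0 (fti t0') fV.
have Vb := field_bound eps_gt0 ft00 (fti t0') (mass t0') fV.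
have force0 := Rintegral_force0 eps_gt0 ft00 (fti t0') (mass t0') fV.
set C := 2 / eps ^+ 2.
have ifV : leb2.-integrable P (EFin \o (fun z => f t z * V' z.1)).
  apply: (integrableM_bounded (m := leb2) (C := C) mP (fti t0') mV).
  by move=> z [z1 _]; exact: Vb.
have bound z : P z -> `|f t z * (V' z.1 * (1 - cutoff' a z.2))| <=
    C * (6 * a ^+ 2) * (f t z * z.2 ^+ 2).
  move=> [z1 _]; rewrite normrM ger0_norm // [leRHS]mulrCA ler_wpM2l //.
  rewrite normrM -mulrA; apply: ler_pM => //; first exact: Vb.
  by rewrite distrC; exact: cutoff'_dist.
have iB : leb2.-integrable P
    (EFin \o (fun z => f t z * (V' z.1 * (1 - cutoff' a z.2)))).
  apply: (@le_integrable _ _ _ leb2 P mP _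
    (fun z => ((C * (6 * a ^+ 2))%:E * (f t z * z.2 ^+ 2)%:E)%E)).
  - apply/measurable_EFinP; apply: measurable_funM.
      by apply/measurable_EFinP; exact: measurable_int (fti t0').
    apply: measurable_funM; first exact: mV.
    by apply: measurable_funB; [exact: measurable_cst|exact: mcutoff'].
  - by move=> z Pz; rewrite /= lee_fin; apply: le_trans (bound z Pz) (ler_norm _).
  - exact: (integrableZl (mu := leb2) mP _ (im2 t0')).
have -> : \int[leb2]_(z in P) (f t z * (z.2 * 0 - V' z.1 * cutoff' a z.2)) =
    \int[leb2]_(z in P) (f t z * (V' z.1 * (1 - cutoff' a z.2))).
  transitivity (\int[leb2]_(z in P)
      (f t z * (V' z.1 * (1 - cutoff' a z.2)) - f t z * V' z.1)).
    by apply: eq_Rintegral => z _; ring.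
  by rewrite RintegralB // force0 subr0.
apply: (le_trans (le_normr_Rintegral _ iB)) => //.
apply: (@le_trans _ _
    (\int[leb2]_(z in P) (C * (6 * a ^+ 2) * (f t z * z.2 ^+ 2)))).
  apply: le_Rintegral => //.
  - exact: integrable_norm iB.
  - exact: (integrableZl (mu := leb2) mP _ (im2 t0')).
rewrite RintegralZl //; last exact: im2.
rewrite -[leLHS]mulrA; apply: ler_wpM2l; first by rewrite divr_ge0 ?sqr_ge0.
by apply: ler_wpM2l; [rewrite mulr_ge0 ?sqr_ge0|exact: m2K].
Qed.

(** The equation holds for positive times only; at time 0 the mean value theorem
needs this continuity, which follows from that of f in L^1 since the cutoff is
bounded. *)
Lemma cutoff_momentum_cvg0 (a : R) : 0 < a ->
  (fun s : R => \int[leb2]_(z in P) (f s z * cutoff a z.2)) @ 0^'+ -->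
  \int[leb2]_(z in P) (f 0 z * cutoff a z.2).
Proof.
move=> a0; have mP := measurable_phase (R := R).
apply/cvgrPdist_le => e e0.
have ea : 0 < a * e by rewrite mulr_gt0.
have c0 := sol_continuous sol (lexx 0).
have := c0; move=> /fine_cvgP[_ /cvgrPdist_le/(_ _ ea)] /=.
rewrite /= nearE /= => H.
have {H} : \forall s \near (0 : R)^'+,
    `|0 - fine (\int[leb2]_(z in P) (`|f s z - f 0 z|)%:E)%E| <= a * e.
  move: H; rewrite /within /at_right /= !nearE; apply: filterS => s H s0.
  exact/H/ltW.
apply: filter_app; near=> s.
have s0 : 0 <= s by [].
rewrite sub0r normrN => H.
rewrite distrC -RintegralB //; [|exact: icutoff|exact: icutoff].
have iB : leb2.-integrable P (EFin \o (fun z => f s z - f 0 z)).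
  exact: (integrableB (mu := leb2) mP (fti s0) (fti (lexx 0))).
have iN := integrable_norm iB.
have iC : leb2.-integrable P
    (EFin \o (fun z => f s z * cutoff a z.2 - f 0 z * cutoff a z.2)).
  exact: (integrableB (mu := leb2) mP (icutoff a0 s0) (icutoff a0 (lexx 0))).
apply: (le_trans (le_normr_Rintegral _ iC)) => //.
apply: (@le_trans _ _ (\int[leb2]_(z in P) (a^-1 * `|f s z - f 0 z|))).
  apply: le_Rintegral => //.
  - exact: integrable_norm iC.
  - exact: (integrableZl (mu := leb2) mP _ iN).
  - by move=> z _; rewrite -mulrBl normrM mulrC ler_wpM2r ?cutoff_bound.
rewrite RintegralZl // ler_pdivrMl //.
exact: le_trans (ler_norm _) H.
Unshelve. all: by end_near. Qed.

Lemma momentum_conserved (t : R) : 0 <= t ->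
  \int[leb2]_(z in P) (f t z * z.2) = \int[leb2]_(z in P) (f 0 z * z.2).
Proof.
rewrite le_eqVlt => /predU1P[<- //|t0].
have K0 : 0 <= K.
  apply: le_trans (m2K (lexx 0)); apply: Rintegral_ge0 => z _.
  by rewrite mulr_ge0 ?sqr_ge0 ?ft0.
(* a^2 C bounds the change up to time t of the momentum cut off at 1 / a, and
   4 a K the cost of the cutoff at both times. *)
set C := (2 / eps ^+ 2) * (6 * K) * t.
have C0 : 0 <= C by rewrite !mulr_ge0 ?invr_ge0 ?sqr_ge0 // ltW.
have main (a : R) : 0 < a ->
    `|\int[leb2]_(z in P) (f t z * z.2) - \int[leb2]_(z in P) (f 0 z * z.2)|
    <= 4 * a * K + a ^+ 2 * C.
  move=> a0; set F := fun s : R => \int[leb2]_(z in P) (f s z * cutoff a z.2).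
  have [c c0t eF] : exists2 c, c \in `]0, t[ & F t - F 0 = derive1 F c * (t - 0).
    apply: MVT => //.
    - move=> x; rewrite in_itv /= => /andP[x0 _].
      have [D dF _] := cutoff_momentum_derivative a0 x0.
      by apply: DeriveDef; [case: dF|rewrite derive1E].
    - apply/continuous_within_itvP => //; split.
      + move=> x; rewrite in_itv /= => /andP[x0 _].
        have [D dF _] := cutoff_momentum_derivative a0 x0.
        by apply: differentiable_continuous; apply/derivable1_diffP; case: dF.
      + exact: cutoff_momentum_cvg0.
      + apply: cvg_at_left_filter.
        have [D dF _] := cutoff_momentum_derivative a0 t0.
        by apply: differentiable_continuous; apply/derivable1_diffP; case: dF.
  move: c0t; rewrite in_itv /= => /andP[c0 _].
  have [D dF DK] := cutoff_momentum_derivative a0 c0.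
  have FtF0 : `|F t - F 0| <= a ^+ 2 * C.
    rewrite eF subr0 derive1E derive_val normrM (gtr0_norm t0).
    apply: (@le_trans _ _ ((2 / eps ^+ 2) * (6 * a ^+ 2 * K) * t)).
      by rewrite ler_wpM2r // ltW.
    by rewrite le_eqVlt; apply/orP; left; apply/eqP; rewrite /C; ring.
  have := cutoff_momentum_dist a0 (ltW t0); have := cutoff_momentum_dist a0 (lexx 0).
  rewrite -/(F t) -/(F 0); move: FtF0.
  rewrite !ler_norml => /andP[? ?] /andP[? ?] /andP[? ?].
  by apply/andP; split; lra.
apply/eqP; rewrite -subr_eq0 -normr_le0; apply/ler_addgt0Pl => e e0; rewrite addr0.
pose a := Num.min 1 (e / (4 * K + C + 1)).
have d0 : 0 < 4 * K + C + 1 by lra.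
have a0 : 0 < a by rewrite lt_min ltr01 divr_gt0.
apply: (le_trans (main a a0)).
have a1 : a <= 1 by rewrite ge_min lexx.
have ae : a * (4 * K + C + 1) <= e by rewrite -ler_pdivlMr // ge_min lexx orbT.
apply: le_trans ae.
have : 0 <= a * C * (1 - a) by rewrite mulr_ge0 ?subr_ge0 // mulr_ge0 // ltW.
by clearbody C; lra.
Qed.
End momentum.

(** * Densities that agree almost everywhere *)

Section ae_equal_densities.
Context {R : realType}.
Local Notation P := (@phase R).
Local Notation I01 := (`[0%R, 1%R]%classic : set R).
Variables (eps : R) (f g : R * R -> R) (V W : R -> R).
Hypotheses (eps_gt0 : 0 < eps).
Hypotheses (f0 : forall z, 0 <= f z) (g0 : forall z, 0 <= g z).
Hypothesis fi : leb2.-integrable P (EFin \o f).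
Hypothesis gi : leb2.-integrable P (EFin \o g).
Hypotheses (fV : poisson eps f V) (gW : poisson eps g W).
Hypothesis fg : {ae leb2, forall z, f z = g z}.

Let mf : measurable_fun P f.
Proof. by apply/measurable_EFinP; exact: measurable_int fi. Qed.

Let mg : measurable_fun P g.
Proof. by apply/measurable_EFinP; exact: measurable_int gi. Qed.

Lemma ae_eq_phase_integral (F : R * R -> R -> R) :
  measurable_fun P (fun z => F z (f z)) -> measurable_fun P (fun z => F z (g z)) ->
  (\int[leb2]_(z in P) (F z (f z))%:E = \int[leb2]_(z in P) (F z (g z))%:E)%E.
Proof.
move=> mFf mFg; apply: ae_eq_integral.
- exact: measurable_phase.
- exact/measurable_EFinP.
- exact/measurable_EFinP.
- have [N [mN N0 sub]] := fg; exists N; split => // z /= nz; apply: sub => /= fgz.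
  by apply: nz => _; rewrite fgz.
Qed.

(* Both are integrals over phase space, of f and g times the indicator of [0, x],
   which spares the almost everywhere equality of the densities. *)
Let density_integral_eq x : I01 x ->
  \int[leb]_(y in `[0, x]) density f y = \int[leb]_(y in `[0, x]) density g y.
Proof.
rewrite /= in_itv /= => /andP[x0 x1].
have step (h : R * R -> R) : (forall z, 0 <= h z) -> leb2.-integrable P (EFin \o h) ->
  \int[leb]_(y in `[0, x]) density h y =
  \int[leb2]_(z in P) (h z * (\1_(`[0, x]%classic : set R) z.1)).
  move=> h0 hi.
  have mh : measurable_fun P h by apply/measurable_EFinP; exact: measurable_int hi.
  rewrite -Rintegral_density.
    rewrite (_ : `[0, x]%classic = I01 `&` (`[0, x]%classic : set R)); last first.
      apply/seteqP; split => y /=; rewrite !in_itv /=.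
        by move=> /andP[-> yx]; rewrite yx (le_trans yx x1).
      by move=> [].
    rewrite Rintegral_mkcondr; apply: eq_Rintegral => y; rewrite inE => Iy.
    rewrite (density_mull _ h0 mh) // patchE indicE.
    rewrite (_ : (y \in I01 `&` _) = (y \in (`[0, x]%classic : set R))).
      by case: (y \in _); rewrite ?mulr1 ?mulr0.
    by rewrite in_setI mem_set.
  apply: (integrableM_bounded (m := leb2) (C := 1) (measurable_phase (R := R)) hi).
    apply: measurableT_comp => //.
    exact: (measurable_funS measurableT (@subsetT _ _) measurable_fst).
  by move=> z _; rewrite indicE normr_nat lern1 leq_b1.
rewrite !step //; congr fine.
have mi :
    measurable_fun P (fun z : R * R => \1_(`[0, x]%classic : set R) z.1 : R).
  apply: measurableT_comp => //.
  exact: (measurable_funS measurableT (@subsetT _ _) measurable_fst).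
by apply: (ae_eq_phase_integral
  (F := fun z r => r * \1_(`[0, x]%classic : set R) z.1)); apply: measurable_funM.
Qed.

(** The equal densities give V' - W' constant; both fields have zero mean over a
period, so the constant is 0. *)
Lemma ae_eq_field x : I01 x -> derive1 V x = derive1 W x.
Proof.
have diff y : I01 y -> derive1 V y - derive1 W y = derive1 V 0 - derive1 W 0.
  move=> Iy; rewrite (field_eq eps_gt0 fV Iy) (field_eq eps_gt0 gW Iy).
  have [y0 y1] : 0 <= y /\ y <= 1 by move: Iy; rewrite /= in_itv /= => /andP[].
  have sub : `[0, y]%classic `<=` I01.
    by move=> u /=; rewrite !in_itv /= => /andP[-> uy]; rewrite (le_trans uy y1).
  have split h : leb2.-integrable P (EFin \o h) ->
      \int[leb]_(u in `[0, y]) (density h u - 1) =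
      \int[leb]_(u in `[0, y]) density h u - \int[leb]_(u in `[0, y]) (cst 1 u).
    move=> hi; rewrite RintegralB //.
      exact: integrableS (integrable_density hi).
    apply: continuous_compact_integrable; first exact: segment_compact.
    by apply: continuous_subspaceT => u; exact: cvg_cst.
  by rewrite !split // density_integral_eq //; ring.
have ID (U : R -> R) h : leb2.-integrable P (EFin \o h) -> poisson eps h U ->
    leb.-integrable I01 (EFin \o derive1 U).
  move=> hi hU; apply: continuous_compact_integrable; first exact: segment_compact.
  exact: field_continuous eps_gt0 hi hU.
have : \int[leb]_(y in I01) (derive1 V y - derive1 W y) = 0.
  rewrite RintegralB //; [|exact: ID fi fV|exact: ID gi gW].
  by rewrite (Rintegral_field0 eps_gt0 fi fV) (Rintegral_field0 eps_gt0 gi gW) subrr.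
have -> : \int[leb]_(y in I01) (derive1 V y - derive1 W y) =
    \int[leb]_(y in I01) (derive1 V 0 - derive1 W 0 : R).
  by apply: eq_Rintegral => y; rewrite inE => /diff.
rewrite Rintegral_cst // [fine _](_ : _ = 1); last first.
  exact: (congr1 fine (lebesgue_measure_unit R)).
by rewrite mulr1 => d0 Ix; apply/eqP; rewrite -subr_eq0 diff // d0.
Qed.

Lemma ae_eq_field_energy : field_energy eps V = field_energy eps W.
Proof.
rewrite /field_energy; under eq_integral => x.
  by rewrite inE => Ix; rewrite (ae_eq_field Ix); over.
by [].
Qed.

Lemma ae_eq_energy : energy eps f V = energy eps g W.
Proof.
rewrite /energy ae_eq_field_energy; congr (_ * _ + _)%E.
have mv2 : measurable_fun P (fun z : R * R => `|z.2| ^+ 2).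
  by apply: measurable_funX; apply: measurableT_comp => //; exact: measurable_v.
by apply: (ae_eq_phase_integral (F := fun z r => r * `|z.2| ^+ 2)); apply: measurable_funM.
Qed.

End ae_equal_densities.

(** * Kinetic and field energies *)

Section modulated.
Context {R : realType}.
Local Notation P := (@phase R).

Lemma field_energy_ge0 (eps : R) (V : R -> R) : (0 <= field_energy eps V)%E.
Proof.
apply: mule_ge0; first by rewrite lee_fin divr_ge0 ?sqr_ge0.
by apply: integral_ge0 => x _; rewrite lee_fin sqr_ge0.
Qed.

Section kinetic_expansion.
Variables (f : R * R -> R) (vbar : R).
Hypothesis f0 : forall z, 0 <= f z.
Hypothesis fi : leb2.-integrable P (EFin \o f).
Hypothesis mass : \int[leb2]_(z in P) f z = 1.
Hypothesis moment2 : (\int[leb2]_(z in P) (f z * `|z.2| ^+ 2)%:E < +oo)%E.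

Lemma kinetic_moments :
  (\int[leb2]_(z in P) (kinetic vbar z.2 * f z)%:E =
  (2^-1 * \int[leb2]_(z in P) (f z * z.2 ^+ 2)
   - vbar * \int[leb2]_(z in P) (f z * z.2) + vbar ^+ 2 / 2)%:E)%E.
Proof.
have mP := measurable_phase (R := R).
have i2 := integrable_moment2 f0 fi moment2.
have i1 := integrable_moment1 f0 fi moment2.
have j2 : leb2.-integrable P (EFin \o (fun z => 2^-1 * (f z * z.2 ^+ 2))).
  exact: (integrableZl (mu := leb2) mP 2^-1 i2).
have j1 : leb2.-integrable P (EFin \o (fun z => vbar * (f z * z.2))).
  exact: (integrableZl (mu := leb2) mP vbar i1).
have j0 : leb2.-integrable P (EFin \o (fun z => vbar ^+ 2 / 2 * f z)).
  exact: (integrableZl (mu := leb2) mP (vbar ^+ 2 / 2) fi).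
have j21 : leb2.-integrable P
    (EFin \o (fun z => 2^-1 * (f z * z.2 ^+ 2) - vbar * (f z * z.2))).
  exact: (integrableB (mu := leb2) mP j2 j1).
have j : leb2.-integrable P (EFin \o (fun z =>
    2^-1 * (f z * z.2 ^+ 2) - vbar * (f z * z.2) + vbar ^+ 2 / 2 * f z)).
  exact: (integrableD (mu := leb2) mP j21 j0).
transitivity (\int[leb2]_(z in P)
    (2^-1 * (f z * z.2 ^+ 2) - vbar * (f z * z.2) + vbar ^+ 2 / 2 * f z)%:E)%E.
  apply: eq_integral => z _; congr (_%:E).
  by rewrite /kinetic real_normK ?num_real //; field.
rewrite -[LHS]fineK; last exact: integrable_fin_num.
congr (_%:E); rewrite -[LHS]/(Rintegral _ _ _).
rewrite RintegralD // RintegralB //.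
by rewrite !RintegralZl // mass mulr1.
Qed.
End kinetic_expansion.
End modulated.

(** Kinetic and field energies are both finite once their sum is; the bound on the
second moment then depends on the conserved energy alone. *)
Lemma energy_split (R : realType) (M F E : \bar R) :
  (0 <= M)%E -> (0 <= F)%E -> ((2^-1)%:E * M + F = E)%E -> (E < +oo)%E ->
  [/\ (M <= (2 * fine E)%:E)%E, F = (fine F)%:E & 2^-1 * fine M = fine E - fine F].
Proof.
case: M => [m| |] //; last first.
  by rewrite gt0_muley ?lte_fin ?invr_gt0 //; case: F => [r| |] // _ _ <-.
case: F => [r| |] //; last by move=> _ _ <-.
rewrite !lee_fin => m0 r0 <- _; split=> //=; last by ring.
by rewrite ?lee_fin; lra.
Qed.

(** Here e is the total energy, a and b are the two field energies and p, q the
conserved momentum and mass terms; H and H' may be infinite. *)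
Lemma transfer_energy (R : realType) (H H' : \bar R) (e a b p q : R) :
  (H + (e - b - p + q)%:E = H' + (e - a - p + q)%:E)%E -> (H + a%:E = H' + b%:E)%E.
Proof.
case: H H' => [h| |] [h'| |] //=; rewrite -!EFinD => -[] h_eq; congr (_%:E).
by lra.
Qed.

(** * The Lyapunov functional *)

Theorem theorem2p2 (R : realType) (mu phi Q : R -> R) (vbar eta : R)
    (mu_stable : S_stable mu vbar)
    (mu_phi : profile_function mu vbar phi)
    (Q_adm : admissible phi Q)
    (eta_gt0 : 0 < eta)
    (mu_moment : (\int[leb]_v (mu v * (1 + `|v| `^ (2 + eta)))%:E < +oo)%E)
    (eps : R) (eps_gt0 : 0 < eps)
    (f0 : R * R -> R) (V0 : R -> R) (f0_init : initial_datum eps f0 V0)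
    (f : R -> R * R -> R) (V : R -> R -> R)
    (fV_sol : strong_solution eps f0 f V) :
  forall t : R, 0 <= t ->
    modulated_energy eps mu Q (f t) (V t) = modulated_energy eps mu Q f0 V0.
Proof.
move=> t t0.
have [_ f00 f0i f0m f0V f0E] := f0_init.
have ft0 s : 0 <= s -> forall z, 0 <= f s z by move=> s0 z; exact: sol_ge0 fV_sol s z s0.
have fti s : 0 <= s -> leb2.-integrable (@phase R) (EFin \o f s).
  exact: sol_integrable fV_sol s.
have mf s : 0 <= s -> measurable_fun (@phase R) (f s).
  by move=> s0; apply/measurable_EFinP; exact: measurable_int (fti s s0).
have mf0 : measurable_fun (@phase R) f0 by apply/measurable_EFinP; exact: measurable_int f0i.
have fV := sol_poisson fV_sol.
have ae0 := sol_initial fV_sol.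
have le00 : 0 <= 0 :> R := lexx 0.
have massE s : 0 <= s -> (\int[leb2]_(z in @phase R) (f s z)%:E = 1)%E.
  move=> s0; rewrite (sol_casimir fV_sol (G := id)) //; last first.
    by apply: continuous_subspaceT => x; exact: cvg_id.
  rewrite -f0m; apply: (ae_eq_phase_integral ae0 (F := fun=> id)) => //.
  exact: mf.
have mass s : 0 <= s -> \int[leb2]_(z in @phase R) f s z = 1.
  by move=> s0; rewrite /Rintegral massE.
have E0 : energy eps (f 0) (V 0) = energy eps f0 V0.
  exact: (ae_eq_energy eps_gt0 (ft0 0 le00) f00 (fti 0 le00) f0i (fV 0 le00) f0V ae0).
have H0 : casimir_functional mu Q (f 0) = casimir_functional mu Q f0.
  apply: (ae_eq_phase_integral ae0 (F := fun z r => bregman Q r (mu z.2))).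
    exact: (measurable_bregman mu_stable mu_phi Q_adm (ft0 0 le00) (mf 0 le00)).
  exact: (measurable_bregman mu_stable mu_phi Q_adm f00 mf0).
have FE0 : field_energy eps (V 0) = field_energy eps V0.
  exact: (ae_eq_field_energy eps_gt0 (ft0 0 le00) f00 (fti 0 le00) f0i
    (fV 0 le00) f0V ae0).
pose M s := (\int[leb2]_(z in @phase R) (f s z * `|z.2| ^+ 2)%:E)%E.
have M0 s : 0 <= s -> (0 <= M s)%E.
  by move=> s0; apply: integral_ge0 => z _; rewrite lee_fin mulr_ge0 ?sqr_ge0 ?ft0.
set E := fine (energy eps f0 V0).
have energyE s : 0 <= s -> [/\ (M s <= (2 * E)%:E)%E,
    field_energy eps (V s) = (fine (field_energy eps (V s)))%:E &
    2^-1 * fine (M s) = E - fine (field_energy eps (V s))].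
  move=> s0; apply: energy_split f0E; [exact: M0|exact: field_energy_ge0|].
  by rewrite -E0; exact: sol_energy fV_sol s s0.
have M2E s : 0 <= s -> (M s <= (2 * E)%:E)%E by move=> s0; case: (energyE s s0).
have Mfin s : 0 <= s -> (M s < +oo)%E.
  by move=> s0; apply: le_lt_trans (M2E s s0) (ltry _).
have equi (G : R -> R) : {within `[0, +oo[, continuous G} ->
    (\int[leb2]_(z in @phase R) (G (f t z))%:E =
     \int[leb2]_(z in @phase R) (G (f 0 z))%:E)%E.
  by move=> cG; exact: (sol_casimir fV_sol cG t0).
have cG n : {within `[0, +oo[, continuous (trunc_casimir phi Q n)}.
  exact: trunc_casimir_continuous mu_phi Q_adm n.
have HW : (casimir_functional mu Q (f t) +
    \int[leb2]_(z in @phase R) (kinetic vbar z.2 * f 0%R z)%:E =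
  casimir_functional mu Q (f 0%R) +
    \int[leb2]_(z in @phase R) (kinetic vbar z.2 * f t z)%:E)%E.
  have m_eq : (\int[leb2]_(z in @phase R) (f t z)%:E =
      \int[leb2]_(z in @phase R) (f 0%R z)%:E)%E.
    exact: etrans (massE t t0) (esym (massE 0 le00)).
  have m_fin s : 0 <= s -> (\int[leb2]_(z in @phase R) (f s z)%:E < +oo)%E.
    by move=> s0; rewrite (massE s s0) ltry.
  have equin n := equi _ (cG n).
  apply/eqP; rewrite eq_le; apply/andP; split.
    exact: (casimir_kinetic_le mu_stable mu_phi Q_adm (ft0 t t0) (ft0 0 le00)
      (mf t t0) (mf 0 le00) m_eq (m_fin t t0) equin).
  exact: (casimir_kinetic_le mu_stable mu_phi Q_adm (ft0 0 le00) (ft0 t t0)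
    (mf 0 le00) (mf t t0) (esym m_eq) (m_fin 0 le00) (fun n => esym (equin n))).
have kin s : 0 <= s -> (\int[leb2]_(z in @phase R) (kinetic vbar z.2 * f s z)%:E =
    (E - fine (field_energy eps (V s)) - vbar * \int[leb2]_(z in @phase R) (f 0%R z * z.2)
     + vbar ^+ 2 / 2)%:E)%E.
  move=> s0; rewrite (kinetic_moments vbar (ft0 s s0) (fti s s0) (mass s s0) (Mfin s s0)).
  rewrite (momentum_conserved eps_gt0 fV_sol mass M2E s0) Rintegral_moment2.
  by case: (energyE s s0) => _ _ <-.
rewrite /modulated_energy -H0 -FE0.
have [_ -> _] := energyE t t0; have [_ -> _] := energyE 0 le00.
move: HW; rewrite (kin t t0) (kin 0 le00) => HW.
exact: (transfer_energy HW).
Qed.
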